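(* In dimension $d=2$, every copula $C$ satisfies $$S(C,C)\ \le\ S(C^\circ,C^\circ)=\frac{\pi}{6}.$$ In dimension $d=3$, every copula $C$ satisfies $$S(C,C)\ \le\ S(C^\circ,C^\circ)=\frac{2}{3}.$$ Here $C^\circ$ denotes the spherically symmetric copula in the respective dimension.
   Context: A $d$-dimensional copula is a cdf on $\mathbb{R}^d$ all of whose univariate marginals are uniform on $(0,1)$; cdfs are identified with the corresponding probability measures. For cdfs $F,G$ on $\mathbb{R}^d$, $$S(F,G)=\mathbb{E}\left(\|\boldsymbol X-\boldsymbol Y\|_2\right)=\int\|\boldsymbol x-\boldsymbol y\|_2\,F(d\boldsymbol x)\,G(d\boldsymbol y),$$ where $\boldsymbol X\sim F$ and $\boldsymbol Y\sim G$ are independent and $\|\cdot\|_2$ is the Euclidean norm. The spherically symmetric copula $C^\circ$ in dimension $d\in\{2,3\}$ is the distribution of $\left(\frac{X_1+1}{2},\dots,\frac{X_d+1}{2}\right)$, where $\boldsymbol X=(X_1,\dots,X_d)$ is the following spherically symmetric random vector with marginals uniform on $[-1,1]$: for $d=3$, $\boldsymbol X$ is uniformly distributed on the unit sphere $\{\boldsymbol x\in\mathbb{R}^3:\|\boldsymbol x\|_2=1\}$; for $d=2$, $\boldsymbol X$ has density $$f(x,y)=\frac{1}{2\pi\sqrt{1-x^2-y^2}}\,\boldsymbol 1_{[x^2+y^2<1]}.$$ *)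

(* Defs.v *)
From HB Require Import structures.
From mathcomp Require Import all_boot all_order all_algebra.
From mathcomp Require Import all_classical all_reals all_analysis.
From mathcomp Require Import measurable_realfun.
From mathcomp Require Import ring lra.

Set Implicit Arguments.
Unset Strict Implicit.
Unset Printing Implicit Defensive.

Import Order.TTheory GRing.Theory Num.Theory.
Import numFieldNormedType.Exports.

Local Open Scope classical_set_scope.
Local Open Scope ring_scope.

Section measurability.
Context {d : measure_display} {T : measurableType d} {R : realType}.
Implicit Types f : T -> R.

Lemma measurable_fun_sqrt f : measurable_fun [set: T] f ->
  measurable_fun [set: T] (fun x => Num.sqrt (f x)).
Proof.
move=> mf; apply: (@measurableT_comp _ _ _ _ _ _ (@Num.sqrt R)) => //.
by apply: nondecreasing_measurable => // x y; exact: ler_wsqrtr.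
Qed.

Lemma measurable_fun_invr f :
  (forall x, 0 <= f x) -> measurable_fun [set: T] f ->
  measurable_fun [set: T] (fun x => (f x)^-1).
Proof.
move=> f0 mf; under eq_fun do rewrite -powR_inv1//.
by apply: (@measurableT_comp _ _ _ _ _ _ (@powR R ^~ (-1))).
Qed.

End measurability.

Section arcsine.
Context {R : realType}.
Notation mu := (@lebesgue_measure R).
Variable s : R.
Hypothesis s0 : 0 < s.

Let k (y : R) : R := (Num.sqrt (s ^+ 2 - y ^+ 2))^-1.

Let pos y : - s < y < s -> 0 < s ^+ 2 - y ^+ 2.
Proof.
by move=> /andP[sy ys]; rewrite subr_sqr mulr_gt0//; lra.
Qed.

Let ck y : - s < y < s -> {for y, continuous k}.
Proof.
move=> ysy; apply: cvgV; first by rewrite sqrtr_eq0 -ltNge pos.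
apply: continuous_cvg; first exact: sqrt_continuous.
by apply: cvgB; [exact: cvg_cst|exact: exprn_continuous].
Qed.

Let dF y : - s < y < s -> is_derive y 1 (@asin R \o ( *%R s^-1)) (k y).
Proof.
move=> /[dup] ysy /andP[sy ys].
have h : -1 < s^-1 * y < 1.
  by rewrite mulrC ltr_pdivlMr// ltr_pdivrMr// mulN1r mul1r sy.
have -> : k y = (Num.sqrt (1 - (s^-1 * y) ^+ 2))^-1 * s^-1.
  rewrite /k -invfM; congr (_^-1).
  rewrite -[X in _ * X](gtr0_norm s0) -sqrtr_sqr -sqrtrM; last first.
    rewrite subr_ge0 -real_normK ?num_real// expr_le1// ler_norml.
    by case/andP: h => *; rewrite !ltW.
  by congr Num.sqrt; field; rewrite gt_eqF.
apply: is_derive1_comp.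
have := is_deriveZ s^-1 (is_derive_id y (1 : R)).
by rewrite /GRing.scale/= mulr1.
Qed.

Let th (n : nat) : R := pi / 2 * (1 - n.+2%:R^-1).
Let t n : R := s * sin (th n).

Let th_itv n : 0 < th n < pi / 2.
Proof.
have p0 : 0 < (pi : R) / 2 by rewrite divr_gt0// pi_gt0.
have n1 : n.+2%:R^-1 < 1 :> R by rewrite invf_lt1// ltr1n.
have n0 : 0 < n.+2%:R^-1 :> R by rewrite invr_gt0.
rewrite /th mulr_gt0 ?subr_gt0//=.
by rewrite gtr_pMr// ltrBlDr ltrDl.
Qed.

Let th_itvNpi2 n : th n \in `[(- (pi / 2)), pi / 2].
Proof.
have /andP[a b] := th_itv n; rewrite in_itv/=.
have p0 : 0 < (pi : R) / 2 by rewrite divr_gt0// pi_gt0.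
lra.
Qed.

Let sin_th n : 0 < sin (th n) < 1.
Proof.
have /andP[a b] := th_itv n; rewrite sin_gt0_pihalf ?th_itv//=.
have p0 : 0 < (pi : R) / 2 by rewrite divr_gt0// pi_gt0.
by rewrite -sin_pihalf ltr_sin// in_itv/=; lra.
Qed.

Let t_itv n : 0 < t n < s.
Proof.
have /andP[a b] := sin_th n; rewrite /t mulr_gt0//=.
by rewrite gtr_pMr.
Qed.

Let asin_t n : asin (s^-1 * t n) = th n.
Proof. by rewrite /t mulKf ?gt_eqF// sinK. Qed.

Let asin_tN n : asin (s^-1 * - t n) = - th n.
Proof.
rewrite /t mulrN mulKf ?gt_eqF// -sinN sinK//.
by have := th_itvNpi2 n; rewrite !in_itv/= => /andP[? ?]; lra.
Qed.

Let sub n y : - t n <= y <= t n -> - s < y < s.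
Proof. by have := t_itv n; lra. Qed.

Let FTC n : (\int[mu]_(y in `[(- t n)%R, t n]) (k y)%:E = (th n *+ 2)%R%:E)%E.
Proof.
have /andP[a b] := t_itv n.
have ab : - t n < t n by lra.
have cF y : - t n <= y <= t n -> {for y, continuous (@asin R \o ( *%R s^-1))}.
  move=> /sub/dF dFy; have : derivable (@asin R \o ( *%R s^-1)) y 1.
    exact: ex_derive.
  by move=> /derivable1_diffP/differentiable_continuous.
rewrite (@continuous_FTC2 _ _ (@asin R \o ( *%R s^-1)))//.
- by rewrite /= asin_t asin_tN -EFinB opprK mulr2n.
- apply: continuous_in_subspaceT => y; rewrite inE/= in_itv/= => ty.
  by apply: ck; exact: sub ty.
- split.
  + move=> y; rewrite in_itv/= => /andP[ya yb].
    by apply: ex_derive; apply: dF; apply: (@sub n); rewrite !ltW.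
  + apply: cvg_at_right_filter; apply: cF; lra.
  + apply: cvg_at_left_filter; apply: cF; lra.
- move=> y; rewrite in_itv/= => /andP[ya yb].
  have yy : - s < y < s by apply: (@sub n); rewrite !ltW.
  have := dF yy => /@derive_val; by rewrite derive1E.
Qed.

Let t_nd : {homo t : m n / (m <= n)%N >-> m <= n}.
Proof.
move=> m n mn; rewrite /t ler_pM2l// leNgt ltr_sin// -leNgt /th.
rewrite ler_pM2l ?divr_gt0 ?pi_gt0// lerD2l lerN2.
by rewrite lef_pV2 ?posrE// ler_nat !ltnS.
Qed.

Let th_cvg : th n @[n --> \oo] --> (pi / 2 : R).
Proof.
rewrite -[X in _ --> X]mulr1; apply: cvgMr.
rewrite -[X in _ --> X]subr0; apply: cvgB; first exact: cvg_cst.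
have := @cvg_harmonic R; rewrite -(cvg_shiftn 1)/=.
by apply: cvg_trans; apply: near_eq_cvg; near=> n; rewrite addn1.
Unshelve. all: by end_near. Qed.

Let t_cvg : t n @[n --> \oo] --> s.
Proof.
rewrite -[X in _ --> X]mulr1 -sin_pihalf; apply: cvgMr.
apply: continuous_cvg; last exact: th_cvg.
exact: continuous_sin.
Qed.

Lemma integral_arcsine :
  (\int[mu]_(y in `](- s)%R, s[) (Num.sqrt (s ^+ 2 - y ^+ 2))^-1%R%:E = pi%:E)%E.
Proof.
have -> : `]- s, s[%classic = \bigcup_n `[- t n, t n]%classic.
  apply/seteqP; split => y /=; rewrite in_itv/=.
    move=> ys; have : `|y| < s by rewrite ltr_norml.
    move=> /(@cvgr_gt _ _ _ _ _ _ t_cvg) [N _ /(_ N (leqnn N)) /= /ltW yN].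
    by exists N => //=; rewrite in_itv/= -ler_norml.
  by move=> [n _] /=; rewrite in_itv/= => /sub.
have : (\int[mu]_(y in `[(- t n)%R, t n]) (k y)%:E)%E @[n --> \oo] --> (pi%:E : \bar R).
  under eq_fun do rewrite FTC.
  apply: cvg_EFin; first by near=> n.
  rewrite [X in _ --> X](_ : pi = pi / 2 + pi / 2); last by rewrite -splitr.
  exact: cvgD.
move=> /cvg_lim <- //; apply/esym/cvg_lim => //.
apply: ge0_nondecreasing_set_cvg_integral => //.
- move=> m n mn; apply/subsetPset => y /=; rewrite !in_itv/=.
  have := t_nd mn; lra.
- move=> n; apply/measurable_funTS/measurable_EFinP/measurable_fun_invr => //.
  apply: measurable_fun_sqrt; apply: measurable_funB => //.
- by move=> n y _; rewrite lee_fin invr_ge0 sqrtr_ge0.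
Unshelve. all: by end_near. Qed.

End arcsine.

Section disc.
Context {R : realType}.
Notation mu := (@lebesgue_measure R).

Definition disc_pdf (z : R * R) : R :=
  if z.1 ^+ 2 + z.2 ^+ 2 < 1
  then (2 * pi * Num.sqrt (1 - z.1 ^+ 2 - z.2 ^+ 2))^-1 else 0.

Lemma disc_pdf_ge0 z : 0 <= disc_pdf z.
Proof.
rewrite /disc_pdf; case: ifP => // _.
by rewrite invr_ge0 !mulr_ge0 ?pi_ge0 ?sqrtr_ge0.
Qed.

Lemma measurable_disc_pdf : measurable_fun [set: R * R] disc_pdf.
Proof.
have m1 : measurable_fun [set: R * R] (fun z => z.1 ^+ 2).
  exact: measurable_funX.
have m2 : measurable_fun [set: R * R] (fun z => z.2 ^+ 2).
  exact: measurable_funX.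
apply: measurable_fun_ifT => //.
  by apply: measurable_fun_ltr => //; exact: measurable_funD.
apply: measurable_fun_invr.
  by move=> z; rewrite !mulr_ge0 ?pi_ge0 ?sqrtr_ge0.
apply: measurable_funM => //; apply: measurable_fun_sqrt.
by apply: measurable_funB => //; exact: measurable_funB.
Qed.

Definition disc_prob : set (R * R) -> \bar R :=
  fun A => (\int[mu \x mu]_(z in A) (disc_pdf z)%:E)%E.

Let disc_prob0 : disc_prob set0 = 0%E.
Proof. by rewrite /disc_prob integral_set0. Qed.

Let disc_prob_ge0 A : (0 <= disc_prob A)%E.
Proof. by apply: integral_ge0 => z _; rewrite lee_fin disc_pdf_ge0. Qed.

Let disc_prob_sigma_additive : semi_sigma_additive disc_prob.
Proof.
apply: (@semi_sigma_additive_nng_induced _ _ _ (mu \x mu)%E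
  (fun z => (disc_pdf z)%:E)).
  by apply/measurable_EFinP; exact: measurable_disc_pdf.
by move=> z; rewrite lee_fin disc_pdf_ge0.
Qed.

HB.instance Definition _ := isMeasure.Build _ _ _ disc_prob
  disc_prob0 disc_prob_ge0 disc_prob_sigma_additive.

Let disc_marginal (x : R) : (\int[mu]_y (disc_pdf (x, y))%:E =
  (if (x \in `](- 1)%R, 1%R[)%R then 2^-1 else 0)%R%:E)%E.
Proof.
have p0 : 0 < (pi : R) := pi_gt0 R.
rewrite in_itv/= -ltr_norml -(@ltr_pXn2r _ 2)// ?nnegrE// expr1n.
rewrite real_normK ?num_real//.
have [x1|x1] := ltP (x ^+ 2) 1; last first.
  rewrite integral0_eq// => y _.
  by rewrite /disc_pdf/= ltNge (le_trans x1)// lerDl sqr_ge0.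
set s := Num.sqrt (1 - x ^+ 2).
have s0 : 0 < s by rewrite sqrtr_gt0 subr_gt0.
have s2 : s ^+ 2 = 1 - x ^+ 2 by rewrite sqr_sqrtr// subr_ge0 ltW.
transitivity (\int[mu]_(y in `](- s)%R, s[)
    (((2 * pi)^-1)%R%:E * ((Num.sqrt (s ^+ 2 - y ^+ 2))^-1)%R%:E))%E.
  rewrite [RHS]integral_mkcond; apply: eq_integral => y _.
  rewrite patchE mem_setE in_itv/= -ltr_norml.
  rewrite -(@ltr_pXn2r _ 2 _ `|y|)// ?nnegrE ?ltW// real_normK ?num_real// s2.
  by rewrite ltrBrDl /disc_pdf/=; case: ifPn => // _; rewrite invfM -EFinM.
rewrite ge0_integralZl//=.
- by rewrite integral_arcsine// -EFinM invfM divfK// gt_eqF.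
- apply/measurable_funTS/measurable_EFinP/measurable_fun_invr => //.
  by apply: measurable_fun_sqrt; apply: measurable_funB.
- by rewrite lee_fin invr_ge0 mulr_ge0// ltW.
Qed.

Let disc_probT : disc_prob [set: R * R] = 1%E.
Proof.
rewrite /disc_prob fubini_tonelli1/=; last 2 first.
  by apply/measurable_EFinP; exact: measurable_disc_pdf.
  by move=> z; rewrite lee_fin disc_pdf_ge0.
transitivity (\int[mu]_(x in `](- 1)%R, 1%R[) (2^-1 : R)%:E)%E.
  rewrite [RHS]integral_mkcond; apply: eq_integral => x _.
  by rewrite /fubini_F disc_marginal patchE mem_setE; case: ifP.
rewrite integral_cst//= lebesgue_measure_itv/= lte_fin gtrN// -EFinB -EFinM.
by congr EFin; field.
Qed.

HB.instance Definition _ :=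
  @Measure_isProbability.Build _ _ R disc_prob disc_probT.

End disc.

Section euclidean.
Context {R : realType} {d : nat}.
Implicit Types x y : d.-tuple R.

Definition eucl_norm x : R := Num.sqrt (\sum_(i < d) tnth x i ^+ 2).

Definition eucl_dist x y : R :=
  Num.sqrt (\sum_(i < d) (tnth x i - tnth y i) ^+ 2).

Definition radial_proj x : d.-tuple R :=
  [tuple tnth x i / eucl_norm x | i < d].

Definition to_unit_cube x : d.-tuple R := [tuple (tnth x i + 1) / 2 | i < d].

Lemma eucl_norm_ge0 x : 0 <= eucl_norm x.
Proof. exact: sqrtr_ge0. Qed.

Lemma measurable_eucl_norm : measurable_fun [set: d.-tuple R] eucl_norm.
Proof.
apply: measurable_fun_sqrt; apply: measurable_sum => i.
by apply: measurable_funX; exact: measurable_tnth.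
Qed.

Lemma measurable_radial_proj : measurable_fun [set: d.-tuple R] radial_proj.
Proof.
apply/measurable_fun_tnthP => i.
rewrite (_ : _ \o _ = fun x => tnth x i / eucl_norm x); last first.
  by apply/funext => x /=; rewrite tnth_mktuple.
apply: measurable_funM; first exact: measurable_tnth.
by apply: measurable_fun_invr; [exact: eucl_norm_ge0|exact: measurable_eucl_norm].
Qed.

HB.instance Definition _ :=
  isMeasurableFun.Build _ _ _ _ radial_proj measurable_radial_proj.

Lemma measurable_to_unit_cube : measurable_fun [set: d.-tuple R] to_unit_cube.
Proof.
apply/measurable_fun_tnthP => i.
rewrite (_ : _ \o _ = fun x => (tnth x i + 1) / 2); last first.
  by apply/funext => x /=; rewrite tnth_mktuple.
apply: measurable_funM => //; apply: measurable_funD => //.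
exact: measurable_tnth.
Qed.

HB.instance Definition _ :=
  isMeasurableFun.Build _ _ _ _ to_unit_cube measurable_to_unit_cube.

End euclidean.

Section tuples_of_products.
Context {R : realType}.

Definition pair_tuple (z : R * R) : 2.-tuple R := [tuple z.1; z.2].

Definition triple_tuple (z : R * R * R) : 3.-tuple R :=
  [tuple z.1.1; z.1.2; z.2].

Lemma measurable_pair_tuple : measurable_fun [set: R * R] pair_tuple.
Proof.
apply/measurable_fun_tnthP => -[[|[|//]] i2].
- rewrite (_ : _ \o _ = fst); last by apply/funext.
  exact: measurable_fst.
- rewrite (_ : _ \o _ = snd); last by apply/funext.
  exact: measurable_snd.
Qed.

HB.instance Definition _ :=
  isMeasurableFun.Build _ _ _ _ pair_tuple measurable_pair_tuple.

Lemma measurable_triple_tuple : measurable_fun [set: R * R * R] triple_tuple.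
Proof.
apply/measurable_fun_tnthP => -[[|[|[|//]]] i3].
- rewrite (_ : _ \o _ = fst \o fst); last by apply/funext.
  by apply: measurableT_comp; exact: measurable_fst.
- rewrite (_ : _ \o _ = snd \o fst); last by apply/funext.
  by apply: measurableT_comp; [exact: measurable_snd|exact: measurable_fst].
- rewrite (_ : _ \o _ = snd); last by apply/funext.
  exact: measurable_snd.
Qed.

HB.instance Definition _ :=
  isMeasurableFun.Build _ _ _ _ triple_tuple measurable_triple_tuple.

End tuples_of_products.

Section sphere.
Context {R : realType}.
Notation mu := (@lebesgue_measure R).

Definition punctured_ball : set (R * R * R) :=
  [set z | 0 < eucl_norm (triple_tuple z) <= 1].

Lemma measurable_punctured_ball : measurable punctured_ball.
Proof.
have mn : measurable_fun [set: R * R * R] (eucl_norm \o triple_tuple).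
  by apply: measurableT_comp; [exact: measurable_eucl_norm|].
rewrite -[punctured_ball]setTI.
apply: (@measurable_and _ _ _ (fun z => 0 < eucl_norm (triple_tuple z))
  (fun z => eucl_norm (triple_tuple z) <= 1) _ _ _ [set true]) => //.
- exact: measurable_fun_ltr.
- exact: measurable_fun_ler.
Qed.

Notation mu3 := (mu \x mu \x mu)%E.

Let mu3_box (a b : R) : a < b ->
  mu3 (`]a, b]%classic `*` `]a, b]%classic `*` `]a, b]%classic) =
  ((b - a) ^+ 3)%:E.
Proof.
move=> ab; rewrite product_measure1E//=; last exact: measurableX.
have muE : (mu `]a, b]%classic = (b - a)%:E)%E.
  by rewrite lebesgue_measure_itv/= lte_fin ab.
by rewrite product_measure1E//= !muE -!EFinM -expr2 -exprSr.
Qed.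

Let mu3_ball_lty : (mu3 punctured_ball < +oo)%E.
Proof.
apply: (@le_lt_trans _ _ (mu3
    (`](- 2), 1]%classic `*` `](- 2), 1]%classic `*` `](- 2), 1]%classic))).
  apply: le_measure.
  - by rewrite inE; exact: measurable_punctured_ball.
  - by rewrite inE; apply: measurableX => //; exact: measurableX.
  move=> [[x y] z]; rewrite /punctured_ball/= => /andP[_].
  rewrite /eucl_norm !big_ord_recr big_ord0/= add0r.
  rewrite !(tnth_nth 0)/= -[X in _ <= X]sqrtr1 ler_sqrt// !in_itv/= => xyz.
  have b (u : R) : u ^+ 2 <= 1 -> - 2 < u <= 1 by move=> u1; apply/andP; split; nra.
  have := sqr_ge0 x; have := sqr_ge0 y; have := sqr_ge0 z.
  by split; [split|]; apply: b; lra.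
by rewrite mu3_box ?ltry//; lra.
Qed.

Let mu3_ball_gt0 : (0 < mu3 punctured_ball)%E.
Proof.
apply: (@lt_le_trans _ _ (mu3
    (`]0, 2^-1]%classic `*` `]0, 2^-1]%classic `*` `]0, 2^-1]%classic))).
  rewrite mu3_box ?invr_gt0//.
apply: le_measure.
- by rewrite inE; apply: measurableX => //; exact: measurableX.
- by rewrite inE; exact: measurable_punctured_ball.
move=> [[x y] z]/= [[]]; rewrite !in_itv/= => /andP[x0 x1] /andP[y0 y1] /andP[z0 z1].
rewrite /punctured_ball/= /eucl_norm !big_ord_recr big_ord0/= add0r.
rewrite !(tnth_nth 0)/= sqrtr_gt0 -[X in _ <= X]sqrtr1 ler_sqrt//.
by apply/andP; split; nra.
Qed.

Definition ball_prob : set (R * R * R) -> \bar R :=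
  fun A => ((fine (mu3 punctured_ball))^-1%:E * mu3 (A `&` punctured_ball))%E.

Let c_ge0 : 0 <= (fine (mu3 punctured_ball))^-1.
Proof. by rewrite invr_ge0 fine_ge0// ltW. Qed.

Let ball_prob0 : ball_prob set0 = 0%E.
Proof. by rewrite /ball_prob set0I measure0 mule0. Qed.

Let ball_prob_ge0 A : (0 <= ball_prob A)%E.
Proof. by rewrite mule_ge0// lee_fin. Qed.

Let ball_prob_sigma_additive : semi_sigma_additive ball_prob.
Proof.
exact: (@measure_semi_sigma_additive _ _ _ (mscale (NngNum c_ge0)
  (mrestr mu3 measurable_punctured_ball))).
Qed.

HB.instance Definition _ := isMeasure.Build _ _ _ ball_prob
  ball_prob0 ball_prob_ge0 ball_prob_sigma_additive.

Let ball_probT : ball_prob [set: R * R * R] = 1%E.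
Proof.
have fB : mu3 punctured_ball \is a fin_num by rewrite ge0_fin_numE.
rewrite /ball_prob setTI -[X in (_ * X)%E]fineK// -EFinM mulVf//.
by rewrite gt_eqF// fine_gt0// mu3_ball_gt0 mu3_ball_lty.
Qed.

HB.instance Definition _ :=
  @Measure_isProbability.Build _ _ R ball_prob ball_probT.

(* Uniform distribution on the unit sphere, i.e., the normalized surface (cone)
   measure: the law of Z / |Z| with Z uniform on the unit ball. The origin, a
   null set where radial_proj would take the junk value 0, has been removed
   from the ball. *)
Definition sphere_prob : probability (3.-tuple R) R :=
  distribution (distribution ball_prob triple_tuple) radial_proj.

End sphere.

Section copula.
Context {R : realType} {d : nat}.
Implicit Types F G C : probability (d.-tuple R) R.

(* E |X - Y| for independent X ~ F and Y ~ G; extended-real valued since F and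
   G need not have a finite first moment. *)
Definition mean_dist F G : \bar R :=
  (\int[F \x G]_z (eucl_dist z.1 z.2)%:E)%E.

(* Copulas are represented by probability measures rather than by cdfs. *)
Definition is_copula C := forall (i : 'I_d) (A : set R), measurable A ->
  C ((fun x : d.-tuple R => tnth x i) @^-1` A) = uniform_prob (@ltr01 R) A.

End copula.

Section spherical_copulas.
Context (R : realType).

Definition spherical_copula2 : probability (2.-tuple R) R :=
  distribution (distribution (@disc_prob R) pair_tuple) to_unit_cube.

Definition spherical_copula3 : probability (3.-tuple R) R :=
  distribution (@sphere_prob R) to_unit_cube.

End spherical_copulas.

(* Main.v *)
Require Import Defs.
From HB Require Import structures.
From mathcomp Require Import all_boot all_order all_algebra.
From mathcomp Require Import all_classical all_reals all_analysis.
From mathcomp Require Import measurable_realfun ring lra.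

(* For a unit vector u, compare the projection U of X (rescaled to [-1, 1]^d) on
   u with the uniform law on [-1, 1], whose cdf is G. If F is the cdf of U,
     E|U - U'| = \int 2 F (1 - F) <= \int 2 ((1 - F) G^2 + F (1 - G)^2)
               <= 1/3 + E U^2,
   where the first step loses exactly 2 (F - G)^2, so that uniform projections
   give equality. Since |v| is a constant times the average of |<u, v>| over
   directions u, averaging the inequality over u bounds E|X - X'| in terms of
   the sum of the E X_i^2, which is the same for all copulas. It remains to see
   that all the projections of the spherically symmetric law are uniform: in
   dimension 2 this reduces to its first marginal by rotation invariance of the
   Lebesgue measure, in dimension 3 it is Archimedes' theorem, obtained by
   slicing the cone { t |z| <= z_3 } of the unit ball into discs. *)

Set Implicit Arguments.
Unset Strict Implicit.
Unset Printing Implicit Defensive.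

Import Order.TTheory GRing.Theory Num.Theory.
Import numFieldNormedType.Exports.

Local Open Scope classical_set_scope.
Local Open Scope ring_scope.

(** * Integrals of piecewise quadratic functions *)

Section piecewise_quadratic.
Context {R : realType}.
Notation mu := (@lebesgue_measure R).
Implicit Types a b c p q r : R.

(** The middle integrand is the tangent at G of the concave function 2 F (1 - F) of F. Being affine
    in F, it is the mean of a function of a single value of U, so an expression quadratic in the law
    of U gets bounded by a moment of U; tangency at G is what makes laws with uniform projections
    extremal. For one direction, E U^2 still contains the covariances of the copula. They disappear
    in the average because a random direction u satisfies E <u, v>^2 = |v|^2 / d, which leaves only
    the trace of the second moments, fixed by the marginals. Both constants come from one formula.
    If a is the mean of |<u, e>| for a unit vector e, the rescaling to [-1, 1]^d contributes a
    factor 2 and the averaged inequality reads 2 a E|X - X'| <= 1/3 + (1/d) (d/3) = 2/3. On the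
    circle a = 2/pi, on the sphere a = 1/2, hence the bounds pi/6 and 2/3. *)

Lemma is_derive_cubic p q r (t : R) :
  is_derive t 1 (fun t => p / 3 * t ^+ 3 + q / 2 * t ^+ 2 + r * t)
    (p * t ^+ 2 + q * t + r).
Proof.
by apply: is_derive_eq; rewrite /GRing.scale/=; field.
Qed.

Lemma continuous_is_derive (F f : R -> R) :
  (forall t : R, is_derive t 1 F (f t)) -> continuous F.
Proof.
move=> dF t; apply/differentiable_continuous/derivable1_diffP.
by have [] := dF t.
Qed.

Lemma integral_is_derive (F f : R -> R) a b : a <= b -> continuous f ->
    (forall t : R, is_derive t 1 F (f t)) ->
  (\int[mu]_(t in `[a, b]) (f t)%:E = (F b - F a)%:E)%E.
Proof.
rewrite le_eqVlt => /predU1P[->|ab] cf dF.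
  by rewrite set_itv1 integral_set1 subrr.
have cF := continuous_is_derive dF.
rewrite (@continuous_FTC2 _ f F)//.
- exact: continuous_subspaceT.
- split; first by move=> t _; have [] := dF t.
  + exact/cvg_at_right_filter/cF.
  + exact/cvg_at_left_filter/cF.
- by move=> t _; rewrite derive1E; have [_ ->] := dF t.
Qed.

Lemma integral_quadratic p q r a b : a <= b ->
  (\int[mu]_(t in `[a, b[) (p * t ^+ 2 + q * t + r)%:E =
   (p / 3 * (b ^+ 3 - a ^+ 3) + q / 2 * (b ^+ 2 - a ^+ 2) + r * (b - a))%:E)%E.
Proof.
move=> ab; pose f t : R := p * t ^+ 2 + q * t + r.
have cf : continuous f.
  by apply: (@continuous_is_derive _ (fun t => p * (2 * t) + q)) => t;
    apply: is_derive_eq; rewrite /GRing.scale/=; ring.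
rewrite integral_itv_bndo_bndc; last first.
  apply/measurable_EFinP/measurable_funTS.
  exact: continuous_measurable_fun cf.
rewrite (integral_is_derive ab cf (is_derive_cubic p q r)).
congr EFin; ring.
Qed.

Lemma measurable_two_quadratics p q r p' q' r' a b c :
  measurable_fun setT (fun t => if a <= t < b then p * t ^+ 2 + q * t + r
     else if b <= t < c then p' * t ^+ 2 + q' * t + r' else 0).
Proof.
have mq x y z : measurable_fun setT (fun t : R => x * t ^+ 2 + y * t + z).
  by apply: measurable_funD => //; apply: measurable_funD; apply: measurable_funM.
have mi x y : measurable_fun setT (fun t : R => x <= t < y).
  by apply: measurable_and; [exact: measurable_fun_ler|exact: measurable_fun_ltr].
by apply: measurable_fun_ifT => //; apply: measurable_fun_ifT.
Qed.

(** The integrals of [potential u] and of the slice areas of the cone and of the ball all have this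
    shape. The half-open pieces are disjoint, and their nonnegativity lets the integral split
    without an integrability argument. *)
Lemma integral_two_quadratics p q r p' q' r' a b c : a <= b -> b <= c ->
    (forall t, a <= t < b -> 0 <= p * t ^+ 2 + q * t + r) ->
    (forall t, b <= t < c -> 0 <= p' * t ^+ 2 + q' * t + r') ->
  (\int[mu]_t (if a <= t < b then p * t ^+ 2 + q * t + r
     else if b <= t < c then p' * t ^+ 2 + q' * t + r' else 0)%:E =
   (p / 3 * (b ^+ 3 - a ^+ 3) + q / 2 * (b ^+ 2 - a ^+ 2) + r * (b - a)
   + (p' / 3 * (c ^+ 3 - b ^+ 3) + q' / 2 * (c ^+ 2 - b ^+ 2)
      + r' * (c - b)))%:E)%E.
Proof.
move=> ab bc f0 g0; rewrite EFinD -!integral_quadratic//.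
rewrite [X in (_ = X + _)%E]integral_mkcond [X in (_ = _ + X)%E]integral_mkcond.
have mq x y z (D : set R) : measurable D ->
    measurable_fun setT ((fun t : R => (x * t ^+ 2 + y * t + z)%:E) \_ D).
  move=> mD; apply/(measurable_restrictT _ mD)/measurable_funTS/measurable_EFinP.
  by apply: measurable_funD => //; apply: measurable_funD; apply: measurable_funM.
rewrite -ge0_integralD//=; last 4 first.
- by move=> t _; rewrite patchE; case: ifPn => //; rewrite inE/= in_itv/= => /f0.
- exact: mq.
- by move=> t _; rewrite patchE; case: ifPn => //; rewrite inE/= in_itv/= => /g0.
- exact: mq.
apply: eq_integral => t _; rewrite !patchE !mem_setE !in_itv/=.
case: ifPn => [/andP[_ tb]|_]; last by case: ifP; rewrite add0e.
by rewrite leNgt tb/= adde0.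
Qed.

End piecewise_quadratic.

(** * Mean absolute difference in terms of the cdf *)

Section mean_absolute_difference.
Context {d : measure_display} {T : measurableType d} {R : realType}.
Notation mu := (@lebesgue_measure R).

(** The levels [t] that separate [u] from [w] fill an interval of length |u - w|. Adding both orders
    avoids a case distinction, since one of the two intervals is always empty. *)
Lemma integral_abs_layer (u w : R) :
  (\int[mu]_t ((if u <= t < w then 1 else 0) + (if w <= t < u then 1 else 0))%:E
   = `|u - w|%:E)%E.
Proof.
wlog uw : u w / u <= w => [H|].
  case/orP: (le_total u w) => [/H //|/H H']; rewrite distrC -H'.
  by apply: eq_integral => t _; rewrite addrC.
transitivity (\int[mu]_t (\1_`[u, w[%classic t)%:E)%E.
  apply: eq_integral => t _; rewrite indicE mem_setE in_itv/=.
  have -> : (w <= t < u) = false by apply/negbTE/negP => /andP[? ?]; lra.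
  by rewrite addr0; case: ifP.
rewrite integral_indic// setIT.
rewrite [LHS]lebesgue_measure_itv/= lte_fin distrC ger0_norm ?subr_ge0//.
by case: ltP => wu; rewrite -?EFinB//; congr EFin; lra.
Qed.

Variables (P : probability T R) (U : T -> R).
Hypothesis mU : measurable_fun setT U.

Let le_set t := [set x | U x <= t].

Let mle t : measurable (le_set t).
Proof.
rewrite -[le_set t]setTI.
apply: (measurable_fun_ler mU (measurable_cst t) measurableT (Y := [set true])) => //.
Qed.

(** By Tonelli on the layers: the level [t] separates two independent copies of [U] when exactly one
    of them is at most [t], which has probability 2 F (1 - F) at [t]. The half-open layers are
    chosen to match the convention [<=] of the cdf. *)
Lemma integral_abs_diff :
  (\int[P \x P]_z `|U z.1 - U z.2|%:E =
   \int[mu]_t (P [set x | (U x <= t)%R] * (1 - P [set x | (U x <= t)%R]) *+ 2))%E.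
Proof.
under eq_integral do rewrite -integral_abs_layer.
pose f (zt : T * T * R) : \bar R := ((if U zt.1.1 <= zt.2 < U zt.1.2 then 1 else 0) +
  (if U zt.1.2 <= zt.2 < U zt.1.1 then 1 else 0) : R)%:E.
have m1 : measurable_fun setT (fun zt : T * T * R => U zt.1.1).
  exact: (measurableT_comp mU (measurableT_comp measurable_fst measurable_fst)).
have m2 : measurable_fun setT (fun zt : T * T * R => U zt.1.2).
  exact: (measurableT_comp mU (measurableT_comp measurable_snd measurable_fst)).
have mf : measurable_fun setT f.
  apply/measurable_EFinP/measurable_funD; apply: measurable_fun_ifT => //;
  by apply: measurable_and; [apply: measurable_fun_ler|apply: measurable_fun_ltr].
have f0 zt : (0 <= f zt)%E.
  by rewrite lee_fin addr_ge0//; case: ifP.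
pose PP : probability (T * T)%type R := (P \x P)%E.
rewrite (@fubini_tonelli _ _ (T * T)%type _ R PP mu f)//.
apply: eq_integral => t _; rewrite /f/=.
pose A := le_set t; have mA : measurable A := mle t.
rewrite (eq_integral (fun z => (\1_(A `*` ~` A) z)%:E + (\1_(~` A `*` A) z)%:E)%E).
  have mAC : measurable (~` A) by exact: measurableC.
  rewrite ge0_integralD//; last 2 first.
  - by apply/measurable_EFinP; apply: measurable_indic; exact: measurableX.
  - by apply/measurable_EFinP; apply: measurable_indic; exact: measurableX.
  rewrite !integral_indic ?setIT//; try exact: measurableX.
  have pE (X Y : set T) : measurable X -> measurable Y ->
      PP (X `*` Y) = (P X * P Y)%E by move=> *; exact: product_measure1E.
  transitivity (P A * P (~` A) + P (~` A) * P A)%E.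
    by congr (_ + _)%E; exact: pE.
  by rewrite probability_setC// [X in (_ + X)%E]muleC.
have inA x : (x \in A) = (U x <= t) by rewrite mem_setE.
move=> z _; rewrite !indicE EFinD !in_setX !in_setC !inA -!ltNge.
rewrite [(t < U z.1) && _]andbC.
by do 2 case: ifP.
Qed.

End mean_absolute_difference.

(** * Comparison with the uniform law on [-1, 1] *)

Section comparison_with_uniform.
Context {R : realType}.
Notation mu := (@lebesgue_measure R).

Definition unif_cdf (t : R) : R :=
  if t < -1 then 0 else if t < 1 then (1 + t) / 2 else 1.

Lemma measurable_unif_cdf : measurable_fun setT unif_cdf.
Proof.
apply: measurable_fun_ifT => //; first exact: measurable_fun_ltr.
apply: measurable_fun_ifT => //; first exact: measurable_fun_ltr.
by apply: measurable_funM => //; exact: measurable_funD.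
Qed.

(** The mean of [potential (U x) t] over [x] is 2 ((1 - F) G^2 + F (1 - G)^2) at level [t]. *)
Let potential (u t : R) : R :=
  if u <= t then 2 * (1 - unif_cdf t) ^+ 2 else 2 * unif_cdf t ^+ 2.

(** For |u| <= 1 the integral is ((1 + u)^3 + (1 - u)^3) / 6, and equality holds. Beyond, it grows
    only linearly, as 2 |u| - 2/3, and misses the bound by (|u| - 1)^2. This range matters because
    projections of the cube reach up to sqrt d. *)
Let integral_potential (u : R) :
  (\int[mu]_t (potential u t)%:E <= (1 / 3 + u ^+ 2)%:E)%E.
Proof.
have sq1 (t : R) : 0 <= 2^-1 * t ^+ 2 + 1 * t + 2^-1.
  by have := sqr_ge0 (t + 1); nra.
have sq2 (t : R) : 0 <= 2^-1 * t ^+ 2 + -1 * t + 2^-1.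
  by have := sqr_ge0 (t - 1); nra.
have c2 (t : R) : 0 <= 0 * t ^+ 2 + 0 * t + 2 by rewrite !mul0r !add0r.
have [u1|u1] := ltP u (-1).
  rewrite (_ : (\int[mu]_t _)%E = (\int[mu]_t
      (if u <= t < -1 then 0 * t ^+ 2 + 0 * t + 2 else
       if -1 <= t < 1 then 2^-1 * t ^+ 2 + -1 * t + 2^-1 else 0)%:E)%E); last first.
    apply: eq_integral => t _; congr EFin; rewrite /potential /unif_cdf.
    by case: (leP u t); case: (ltP t (-1)); case: (ltP t 1) => /= *;
      try lra; field.
  rewrite integral_two_quadratics//; [|lra..].
  by rewrite lee_fin; have := sqr_ge0 (u + 1); nra.
have [u2|u2] := ltP 1 u.
  rewrite (_ : (\int[mu]_t _)%E = (\int[mu]_t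
      (if -1 <= t < 1 then 2^-1 * t ^+ 2 + 1 * t + 2^-1 else
       if 1 <= t < u then 0 * t ^+ 2 + 0 * t + 2 else 0)%:E)%E); last first.
    apply: eq_integral => t _; congr EFin; rewrite /potential /unif_cdf.
    by case: (leP u t); case: (ltP t (-1)); case: (ltP t 1) => /= *;
      try lra; field.
  rewrite integral_two_quadratics//; [|lra..].
  by rewrite lee_fin; have := sqr_ge0 (u - 1); nra.
rewrite (_ : (\int[mu]_t _)%E = (\int[mu]_t
    (if -1 <= t < u then 2^-1 * t ^+ 2 + 1 * t + 2^-1 else
     if u <= t < 1 then 2^-1 * t ^+ 2 + -1 * t + 2^-1 else 0)%:E)%E); last first.
  apply: eq_integral => t _; congr EFin; rewrite /potential /unif_cdf.
  by case: (leP u t); case: (ltP t (-1)); case: (ltP t 1) => /= *;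
    try lra; field.
by rewrite integral_two_quadratics// lee_fin; lra.
Qed.

Context {d : measure_display} {T : measurableType d}.
Variables (P : probability T R) (U : T -> R).
Hypothesis mU : measurable_fun setT U.

Lemma integral_abs_diff_le :
  (\int[P \x P]_z `|U z.1 - U z.2|%:E <= \int[P]_x (1 / 3 + U x ^+ 2)%:E)%E.
Proof.
rewrite integral_abs_diff//.
pose f (xt : T * R) : \bar R := (potential (U xt.1) xt.2)%:E.
have mG : measurable_fun setT (fun xt : T * R => unif_cdf xt.2).
  by apply: measurableT_comp; [exact: measurable_unif_cdf|exact: measurable_snd].
have mf : measurable_fun setT f.
  apply/measurable_EFinP; apply: measurable_fun_ifT.
  - apply: measurable_fun_ler => //.
    by apply: measurableT_comp => //; exact: measurable_fst.
  - by apply: measurable_funM => //; apply: measurable_funX; exact: measurable_funB.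
  - by apply: measurable_funM => //; exact: measurable_funX.
have f0 xt : (0 <= f xt)%E.
  by rewrite lee_fin /potential; case: ifP => _; rewrite mulr_ge0// sqr_ge0.
(* The double integral of [potential] lies between the two sides: integrating over [t] first gives
   the upper bound pointwise in [x], integrating over [x] first gives the lower bound pointwise in
   [t]. *)
apply: (@le_trans _ _ (\int[mu]_t \int[P]_x f (x, t))%E); last first.
  rewrite -(@fubini_tonelli _ _ T _ R P mu f)//.
  apply: ge0_le_integral => //.
  - by move=> x _; apply: integral_ge0 => t _.
  - exact: (@measurable_fun_fubini_tonelli_F _ _ _ _ _ mu f).
  - apply/measurable_EFinP; apply: measurable_funD => //.
    exact: measurable_funX.
  - by move=> x _; exact: (integral_potential (U x)).
have mle t : measurable [set x | U x <= t].
  rewrite -[X in measurable X]setTI.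
  exact: (measurable_fun_ler mU (measurable_cst t) measurableT (Y := [set true])).
have mPle : measurable_fun setT (fun t => P [set x | U x <= t]).
  (* The cdf is a partial integral of an indicator on the product, hence measurable by Tonelli. *)
  pose h (xt : T * R) : \bar R := (if U xt.1 <= xt.2 then 1 else 0)%:E.
  rewrite (_ : (fun t => _) = fubini_G P h).
    apply: measurable_fun_fubini_tonelli_G => [|xt]; last first.
      by rewrite lee_fin; case: ifP.
    apply/measurable_EFinP; apply: measurable_fun_ifT => //.
    apply: measurable_fun_ler => //.
    by apply: measurableT_comp => //; exact: measurable_fst.
  apply/funext => t; rewrite /fubini_G -[X in P X]setIT -integral_indic//.
  apply: eq_integral => x _.
  by rewrite indicE (_ : (x \in _) = (U x <= t)) ?mem_setE /h; [case: ifP|].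
have mPle' : measurable_fun setT
    (fun t => P [set x | (U x <= t)%R] * (1 - P [set x | (U x <= t)%R]))%E.
  by apply: emeasurable_funM => //; exact: emeasurable_funB.
apply: ge0_le_integral => //.
- move=> t _; have P1 := probability_le1 P (mle t).
  by apply: adde_ge0; apply: mule_ge0 => //; rewrite sube_ge0 ?fin_num_measure.
- exact: emeasurable_funD.
- exact: (@measurable_fun_fubini_tonelli_G _ _ _ _ _ P f).
move=> t _; set A := [set x | U x <= t]; have mA : measurable A := mle t.
have mAC : measurable (~` A) by exact: measurableC.
pose g := unif_cdf t.
have -> : (\int[P]_x f (x, t) = (2 * (1 - g) ^+ 2)%:E * P A
    + (2 * g ^+ 2)%:E * P (~` A))%E.
  have -> : (\int[P]_x f (x, t) = \int[P]_x ((2 * (1 - g) ^+ 2)%:E * (\1_A x)%:E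
    + (2 * g ^+ 2)%:E * (\1_(~` A) x)%:E))%E.
    apply: eq_integral => x _; rewrite /f /potential/= -/g !indicE in_setC.
    rewrite -!EFinM -EFinD (_ : (x \in A) = (U x <= t)) ?mem_setE//.
    by case: ifP => _ /=; congr EFin; ring.
  have mI (X : set T) : measurable X ->
      measurable_fun setT (fun x => (\1_X x)%:E : \bar R).
    by move=> mX; apply/measurable_EFinP; exact: measurable_indic.
  rewrite ge0_integralD//=.
  - rewrite !ge0_integralZl//= ?integral_indic ?setIT//; try exact: mI.
    + by rewrite lee_fin mulr_ge0// sqr_ge0.
    + by rewrite lee_fin mulr_ge0// sqr_ge0.
  - move=> x _; rewrite -EFinM lee_fin; apply: mulr_ge0 => //.
    by apply: mulr_ge0 => //; exact: sqr_ge0.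
  - by apply: emeasurable_funM => //; exact: mI.
  - move=> x _; rewrite -EFinM lee_fin; apply: mulr_ge0 => //.
    by apply: mulr_ge0 => //; exact: sqr_ge0.
  - by apply: emeasurable_funM => //; exact: mI.
rewrite probability_setC// -[P A]fineK ?fin_num_measure//.
rewrite -EFinB -!EFinM -EFinD lee_fin.
by have := sqr_ge0 (fine (P A) - g); nra.
Qed.

Lemma integral_abs_diff_unif :
    (forall t, P [set x | U x <= t] = (unif_cdf t)%:E) ->
  (\int[P \x P]_z `|U z.1 - U z.2|%:E = (2 / 3)%:E)%E.
Proof.
move=> PU; rewrite integral_abs_diff//.
(* On [-1, 1[ the integrand 2 G (1 - G) is (1 - t^2) / 2; the second piece lives on an empty
   interval and only fits the format. *)
rewrite (_ : (\int[mu]_t _)%E = (\int[mu]_t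
    (if -1 <= t < 1 then -2^-1 * t ^+ 2 + 0 * t + 2^-1 else
     if 1 <= t < 1 then 0 * t ^+ 2 + 0 * t + 0 else 0)%:E)%E); last first.
  apply: eq_integral => t _; rewrite PU -EFinB -EFinM -EFin_natmul.
  congr EFin; rewrite /unif_cdf.
  by case: (ltP t (-1)); case: (ltP t 1) => /= *; try lra; field.
rewrite integral_two_quadratics//.
- by congr EFin; field.
- by move=> t /andP[? ?]; nra.
- by move=> t /andP[? ?]; lra.
Qed.

End comparison_with_uniform.

(** * Averaging over random directions *)

Section projections.
Context {R : realType} {d : nat} {dW : measure_display} {W : measurableType dW}.
Notation mu := (@lebesgue_measure R).
(** [tau] governs a random direction with coordinates [theta i]. Directions enter through two
    moments that express isotropy, so a direction may degenerate on a null set. *)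
Variables (tau : probability W R) (theta : 'I_d -> W -> R) (a : R).
Hypothesis mtheta : forall i, measurable_fun setT (theta i).

Definition dir_proj (w : W) (x : d.-tuple R) : R :=
  \sum_(i < d) theta i w * (2 * tnth x i - 1).

Hypothesis a_gt0 : 0 < a.
Hypothesis abs_moment : forall v : 'I_d -> R,
  (\int[tau]_w `|\sum_(i < d) theta i w * v i|%:E =
   (a * Num.sqrt (\sum_(i < d) v i ^+ 2))%:E)%E.

Lemma measurable_proj :
  measurable_fun setT (fun wx : W * d.-tuple R => dir_proj wx.1 wx.2).
Proof.
apply: measurable_sum => i; apply: measurable_funM.
  by apply: measurableT_comp => //; exact: measurable_fst.
apply: measurable_funB => //; apply: measurable_funM => //.
exact: (measurableT_comp (measurable_tnth i) measurable_snd).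
Qed.

Lemma measurable_proj2 w : measurable_fun setT (dir_proj w).
Proof. exact: (measurable_fun_pair2 w measurable_proj). Qed.

Let abs_diff (wz : W * (d.-tuple R * d.-tuple R)) : \bar R :=
  `|dir_proj wz.1 wz.2.1 - dir_proj wz.1 wz.2.2|%:E.

Let measurable_abs_diff : measurable_fun setT abs_diff.
Proof.
  apply/measurable_EFinP; apply: measurableT_comp => //.
  apply: measurable_funB.
    apply: (measurableT_comp measurable_proj
      (g := fun wz : W * (d.-tuple R * d.-tuple R) => (wz.1, wz.2.1))).
    apply: measurable_fun_pair; first exact: measurable_fst.
    exact: (measurableT_comp measurable_fst measurable_snd).
  apply: (measurableT_comp measurable_proj
    (g := fun wz : W * (d.-tuple R * d.-tuple R) => (wz.1, wz.2.2))).
  apply: measurable_fun_pair; first exact: measurable_fst.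
  exact: (measurableT_comp measurable_snd measurable_snd).
Qed.

Let abs_diff_ge0 wz : (0 <= abs_diff wz)%E.
Proof. by rewrite lee_fin. Qed.

Variable C : probability (d.-tuple R) R.
Let CC : probability (d.-tuple R * d.-tuple R)%type R := (C \x C)%E.

(** Tonelli and [abs_moment] at the vector 2 (x - y): the shift by -1 in [dir_proj] cancels in
    differences, the rescaling by 2 does not. *)
Lemma mean_dist_proj : ((2 * a)%:E * mean_dist C C =
  \int[tau]_w \int[C \x C]_z `|dir_proj w z.1 - dir_proj w z.2|%:E)%E.
Proof.
have md : measurable_fun setT
    (fun z : d.-tuple R * d.-tuple R => (eucl_dist z.1 z.2)%:E : \bar R).
  apply/measurable_EFinP/measurable_fun_sqrt; apply: measurable_sum => i.
  apply: measurable_funX; apply: measurable_funB.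
    exact: (measurableT_comp (measurable_tnth i) measurable_fst).
  exact: (measurableT_comp (measurable_tnth i) measurable_snd).
rewrite (fubini_tonelli (m1 := tau) (m2 := CC) abs_diff)//.
rewrite /mean_dist -ge0_integralZl//; last 2 first.
- by move=> z _; rewrite lee_fin sqrtr_ge0.
- by rewrite lee_fin mulr_ge0// ltW.
apply: eq_integral => -[x y] _; rewrite /abs_diff/=.
transitivity (\int[tau]_w `|\sum_(i < d) theta i w * (2 * (tnth x i - tnth y i))|%:E)%E.
  rewrite abs_moment -EFinM; congr EFin.
  under eq_bigr do rewrite exprMn.
  rewrite -mulr_sumr sqrtrM ?sqr_ge0// sqrtr_sqr ger0_norm// mulrA.
  by rewrite [a * 2]mulrC.
apply: eq_integral => w _; congr (EFin `|_|).
by rewrite /dir_proj -sumrB; apply: eq_bigr => i _; ring.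
Qed.

Let scaleE : (((3 * a)^-1)%:E = (2 * a)^-1%:E * (2 / 3)%:E)%E.
Proof. by rewrite -EFinM; congr EFin; field; rewrite gt_eqF. Qed.

(** Each uniform projection contributes 2/3, whence (2/3) / (2 a). Almost every direction suffices:
    in dimension 3 the origin of the ball has no direction. *)
Lemma mean_dist_unif_proj :
    {ae tau, forall w, forall t, C [set x | dir_proj w x <= t] = (unif_cdf t)%:E} ->
  mean_dist C C = ((3 * a)^-1)%:E.
Proof.
move=> Cw; apply/esym/eqP; rewrite scaleE eqe_pdivrMl; last first.
  by rewrite mulf_neq0// gt_eqF.
rewrite mean_dist_proj; apply/eqP/esym.
transitivity (\int[tau]_w cst (2 / 3)%:E w)%E; last first.
  by rewrite integral_cst// [X in (_ * X)%E]probability_setT mule1.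
apply: ge0_ae_eq_integral => //.
- exact: (measurable_fun_fubini_tonelli_F (m2 := CC) _
    measurable_abs_diff abs_diff_ge0).
- by move=> w _; apply: integral_ge0 => z _; rewrite lee_fin.
- by move=> w _; rewrite lee_fin.
- apply: filterS Cw => w Cw _.
  by rewrite integral_abs_diff_unif//; exact: measurable_proj2.
Qed.

Hypothesis sqr_moment : forall v : 'I_d -> R,
  (\int[tau]_w ((\sum_(i < d) theta i w * v i) ^+ 2)%:E =
   (d%:R^-1 * \sum_(i < d) v i ^+ 2)%:E)%E.

Lemma integral_sqr_uniform :
  (\int[uniform_prob (@ltr01 R)]_u ((2 * u - 1) ^+ 2)%:E = (1 / 3)%:E)%E.
Proof.
rewrite integral_uniform//; last 2 first.
- apply/measurable_EFinP/measurable_funX.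
  by apply: measurable_funB => //; apply: measurable_funM.
- by move=> u; rewrite lee_fin sqr_ge0.
rewrite [X in (_ * X)%E](@integral_is_derive R (fun u : R => (2 * u - 1) ^+ 3 / 6)
  (fun u : R => (2 * u - 1) ^+ 2))//.
- by rewrite -EFinM; congr EFin; field.
- apply: (@continuous_is_derive _ _ (fun u => 2 * (2 * (2 * u - 1)))) => u.
  by apply: is_derive_eq; rewrite /GRing.scale/=; ring.
- by move=> u; apply: is_derive_eq; rewrite /GRing.scale/=; field.
Qed.

(** After the exchange of integrals, [sqr_moment] removes all mixed terms, and each remaining (2 X_i
    - 1)^2 has mean 1/3 by the marginal condition. *)
Lemma mean_dist_copula_le : (0 < d)%N -> is_copula C ->
  (mean_dist C C <= ((3 * a)^-1)%:E)%E.
Proof.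
move=> d0 Ccop; rewrite scaleE lee_pdivlMl ?mulr_gt0// mean_dist_proj.
pose g (wx : W * d.-tuple R) : \bar R := (1 / 3 + dir_proj wx.1 wx.2 ^+ 2)%:E.
have mg : measurable_fun setT g.
  apply/measurable_EFinP/measurable_funD => //.
  by apply: measurable_funX; exact: measurable_proj.
have g0 wx : (0 <= g wx)%E by rewrite lee_fin addr_ge0// sqr_ge0.
apply: (@le_trans _ _ (\int[tau]_w \int[C]_x g (w, x))%E).
  apply: ge0_le_integral => //.
  - by move=> w _; apply: integral_ge0 => z _; rewrite lee_fin.
  - exact: (measurable_fun_fubini_tonelli_F (m2 := CC) _
    measurable_abs_diff abs_diff_ge0).
  - exact: (measurable_fun_fubini_tonelli_F (m2 := C) _ mg g0).
  - by move=> w _; apply: integral_abs_diff_le; exact: measurable_proj2.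
have mi i : measurable_fun setT (fun x : d.-tuple R => (2 * tnth x i - 1) ^+ 2).
  apply/measurable_funX/measurable_funB => //; apply: measurable_funM => //.
  exact: measurable_tnth.
have Ci i : (\int[C]_x ((2 * tnth x i - 1) ^+ 2)%:E = (1 / 3)%:E)%E.
  pose X0 (x : d.-tuple R) : measurableTypeR R := tnth x i.
  have mX0 : measurable_fun setT X0 by exact: measurable_tnth.
  pose X : {RV C >-> measurableTypeR R} := HB.pack X0
    (isMeasurableFun.Build _ _ _ _ X0 mX0).
  have mq : measurable_fun setT
      (fun u : measurableTypeR R => ((2 * u - 1) ^+ 2)%:E : \bar R).
    apply/measurable_EFinP/measurable_funX.
    by apply: measurable_funB => //; apply: measurable_funM.
  rewrite -[LHS](ge0_integral_distribution X mq); last first.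
    by move=> u; rewrite lee_fin sqr_ge0.
  rewrite -integral_sqr_uniform.
  by apply: eq_measure_integral => A mA _; exact: Ccop.
rewrite (fubini_tonelli (m1 := tau) (m2 := C) g)//.
rewrite (eq_integral (fun x : d.-tuple R => (1 / 3)%:E +
    d%:R^-1%:E * \sum_(i < d) ((2 * tnth x i - 1) ^+ 2)%:E)%E); last first.
  move=> x _; rewrite /g/=.
  under eq_integral do rewrite EFinD.
  rewrite ge0_integralD//.
  - rewrite (_ : (\int[tau]_w (1 / 3)%:E)%E = (1 / 3)%:E); last first.
      by rewrite integral_cst// [X in (_ * X)%E]probability_setT mule1.
    by rewrite sqr_moment sumEFin EFinM.
  - by move=> w _; rewrite lee_fin sqr_ge0.
  - apply/measurable_EFinP/measurable_funX.
    exact: (measurable_fun_pair1 x measurable_proj).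
rewrite ge0_integralD//; last 2 first.
- move=> x _; rewrite mule_ge0// ?lee_fin ?invr_ge0// sume_ge0// => i _.
  by rewrite lee_fin sqr_ge0.
- apply: emeasurable_funM => //; apply: emeasurable_sum => i.
  exact/measurable_EFinP.
rewrite integral_cst// [X in (_ * X + _)%E]probability_setT mule1.
rewrite ge0_integralZl//; last 2 first.
- by apply: emeasurable_sum => i; exact/measurable_EFinP.
- by move=> x _; apply: sume_ge0 => i _; rewrite lee_fin sqr_ge0.
rewrite ge0_integral_sum//; last 2 first.
- by move=> i; exact/measurable_EFinP.
- by move=> i x _; rewrite lee_fin sqr_ge0.
under eq_bigr do rewrite Ci.
rewrite sumEFin sumr_const card_ord -EFinM -EFinD lee_fin -[_ *+ d]mulr_natr.
rewrite [X in _ + X](_ : _ = 1 / 3); [lra|by field; rewrite pnatr_eq0 -lt0n].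
Qed.

End projections.

(** * Measure-preserving maps and shears *)

Section measure_preserving.
Context {R : realType}.

Definition preserves {d} {T : measurableType d} (m : set T -> \bar R)
    (f : T -> T) :=
  measurable_fun setT f /\ forall A, measurable A -> m (f @^-1` A) = m A.

Lemma preserves_comp {d} {T : measurableType d} (m : set T -> \bar R)
    (f g : T -> T) :
  preserves m f -> preserves m g -> preserves m (f \o g).
Proof.
move=> [mf pf] [mg pg]; split; first exact: measurableT_comp.
move=> A mA; rewrite comp_preimage pg ?pf// -[X in measurable X]setTI.
exact: mf.
Qed.

Lemma preserves_integral {d} {T : measurableType d}
    (m : {measure set T -> \bar R}) (f : T -> T) (h : T -> \bar R) :
    preserves m f -> measurable_fun setT h -> (forall x, 0 <= h x)%E ->
  (\int[m]_x h (f x) = \int[m]_x h x)%E.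
Proof.
move=> [mf pf] mh h0.
pose F : {mfun T >-> T} := HB.pack f (isMeasurableFun.Build _ _ _ _ f mf).
rewrite -[LHS](@ge0_integral_pushforward _ _ _ _ _ F mf m setT h)//.
by apply: eq_measure_integral => A mA _; exact: pf.
Qed.

Notation mu := (@lebesgue_measure R).

(** The image of [mu] under the affine map, multiplied by [k], gives ]a, b] its length, and these
    intervals determine [mu]. *)
Lemma lebesgue_measure_affine (k t : R) (A : set R) : 0 < k -> measurable A ->
  (mu A = k%:E * mu ((fun x : R => k * x + t)%R @^-1` A))%E.
Proof.
move=> k0 mA; have k0' := ltW k0.
pose f (x : measurableTypeR R) : measurableTypeR R := k * x + t.
have mf : measurable_fun setT f.
  by apply: measurable_funD => //; apply: measurable_funM.
pose m := mscale (NngNum k0') (pushforward mu f).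
transitivity (m mf A) => //.
apply: (@lebesgue_measure_unique _ (m mf)) => // _ [[a b]] _ <-.
transitivity (k%:E * mu (f @^-1` `]a, b]))%E => //.
rewrite (_ : f @^-1` _ = `](a - t) / k, (b - t) / k]%classic); last first.
  apply/seteqP; split => x /=; rewrite !in_itv/= /f;
    by rewrite ltr_pdivrMr// ler_pdivlMr// ltrBlDr lerBrDr mulrC.
rewrite !lebesgue_measure_itv/= !lte_fin.
rewrite ltr_pM2r ?invr_gt0// ltrD2r; case: ifP; rewrite ?mule0//.
by move=> _; rewrite -!EFinB -EFinM; congr EFin; field; rewrite gt_eqF.
Qed.

Lemma lebesgue_measure_translation (t : R) (A : set R) : measurable A ->
  mu ((fun x : R => x + t) @^-1` A) = mu A.
Proof.
move=> mA; rewrite (lebesgue_measure_affine t ltr01 mA) mul1e.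
by congr (mu _); apply/funext => x /=; rewrite mul1r.
Qed.

Section shear.
Context d1 d2 (T1 : measurableType d1) (T2 : measurableType d2).
Variables (m1 : {sigma_finite_measure set T1 -> \bar R})
  (m2 : {sigma_finite_measure set T2 -> \bar R}).

(** For increasing exhaustions the diagonal products [F n] by [G n] already cover everything: two
    indices can be replaced by their maximum. *)
Lemma sigma_finite_product : sigma_finite setT (m1 \x m2)%E.
Proof.
have /sigma_finiteP[F [TF ndF Ffin]] := sigma_finiteT m1.
have /sigma_finiteP[G [TG ndG Gfin]] := sigma_finiteT m2.
exists (fun n => F n `*` G n) => [|n].
  apply/seteqP; split => // -[x y] _.
  have [i _ Fx] : (\bigcup_k F k) x by rewrite -TF.
  have [j _ Gy] : (\bigcup_k G k) y by rewrite -TG.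
  exists (maxn i j) => //; split => /=.
    by move: x Fx {TF}; exact/subsetPset/ndF/leq_maxl.
  by move: y Gy {TG}; exact/subsetPset/ndG/leq_maxr.
have [mF Fn] := Ffin n; have [mG Gn] := Gfin n.
split; first exact: measurableX.
by rewrite [X in (X < _)%E]product_measure1E// lte_mul_pinfty// ge0_fin_numE.
Qed.

(** Slicing along the other coordinate, by uniqueness of the product measure; shears of the first
    coordinate and slices of the ball at a given height rely on it. *)
Lemma product_measure12 (A : set (T1 * T2)) : measurable A ->
  ((m1 \x m2) A = \int[m2]_y m1 (ysection A y))%E.
Proof.
move=> mA; apply: (@product_measure_unique _ _ _ _ _ m1 m2 (m1 \x^ m2)%E) => //.
by move=> X Y mX mY; exact: product_measure2E.
Qed.

(** Cavalieri's principle: every slice at fixed [y] is moved within itself by a measure-preserving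
    map. *)
Lemma preserves_shear1 (f : T1 -> T2 -> T1) :
    measurable_fun setT (fun z : T1 * T2 => f z.1 z.2) ->
    (forall y A, measurable A -> m1 ((f ^~ y) @^-1` A) = m1 A) ->
  preserves (m1 \x m2)%E (fun z => (f z.1 z.2, z.2)).
Proof.
move=> mf pf; have mF : measurable_fun setT (fun z : T1 * T2 => (f z.1 z.2, z.2)).
  by apply: measurable_fun_pair => //; exact: measurable_snd.
split=> // A mA; rewrite !product_measure12//; last first.
  by rewrite -[X in measurable X]setTI; exact: mF.
apply: eq_integral => y _.
rewrite -(pf y (ysection A y)); last exact: measurable_ysection.
by congr (m1 _); apply/seteqP; split => x; rewrite /ysection/= !inE.
Qed.

Lemma preserves_shear2 (f : T1 -> T2 -> T2) :
    measurable_fun setT (fun z : T1 * T2 => f z.1 z.2) ->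
    (forall x A, measurable A -> m2 (f x @^-1` A) = m2 A) ->
  preserves (m1 \x m2)%E (fun z => (z.1, f z.1 z.2)).
Proof.
move=> mf pf; have mF : measurable_fun setT (fun z : T1 * T2 => (z.1, f z.1 z.2)).
  by apply: measurable_fun_pair => //; exact: measurable_fst.
split=> // A mA; rewrite /product_measure1.
apply: eq_integral => x _ /=.
rewrite -(pf x (xsection A x)); last exact: measurable_xsection.
by congr (m2 _); apply/seteqP; split => y; rewrite /xsection/= !inE.
Qed.

End shear.

End measure_preserving.

(** * Rotation invariance of the Lebesgue measure *)

Section rotations.
Context {R : realType}.
Notation mu := (@lebesgue_measure R).
Notation mu2 := (mu \x mu)%E.
Notation mu3 := (mu \x mu \x mu)%E.

(* A rotation by phi is a product of three shears, the outer ones having slope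
   -tan(phi / 2), which excludes phi = pi. *)
Lemma preserves_rotation {d} {T : measurableType d} (m : set T -> \bar R)
    (X Y : R -> T -> T) (rot : R -> R -> T -> T) :
    (forall t, preserves m (X t)) -> (forall t, preserves m (Y t)) ->
    (forall c s, c != -1 -> c ^+ 2 + s ^+ 2 = 1 ->
      rot c s = X (- (s / (1 + c))) \o Y s \o X (- (s / (1 + c)))) ->
    rot (-1) 0 = rot 0 1 \o rot 0 1 ->
  forall c s, c ^+ 2 + s ^+ 2 = 1 -> preserves m (rot c s).
Proof.
move=> pX pY rotE rotN.
have rotp c s : c != -1 -> c ^+ 2 + s ^+ 2 = 1 -> preserves m (rot c s).
  move=> c1 cs; rewrite rotE//.
  by apply: preserves_comp => //; exact: preserves_comp.
move=> c s cs; have [c1|] := eqVneq c (-1); last by move=> ?; exact: rotp.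
have -> : s = 0.
  by apply/eqP; rewrite -sqrf_eq0; apply/eqP; move: cs; rewrite c1; nra.
rewrite c1 rotN; have p : preserves m (rot 0 1).
  by apply: rotp; [rewrite eq_sym oppr_eq0 oner_eq0|rewrite expr0n expr1n add0r].
exact: preserves_comp.
Qed.

Definition rotation2 (c s : R) (z : R * R) : R * R :=
  (c * z.1 - s * z.2, s * z.1 + c * z.2).

(** The half-angle formulas in algebraic form: t = - s / (1 + c) satisfies 1 + s t = c and 2 t + s
    t^2 = - s, the entries of the product of the three shears. *)
Let shear_sum (c s x y : R) : c != -1 -> c ^+ 2 + s ^+ 2 = 1 ->
  let t := - (s / (1 + c)) in
  [/\ c * x - s * y = x + t * y + t * (y + s * (x + t * y)) &
    s * x + c * y = y + s * (x + t * y)].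
Proof.
move=> c1 cs t; have c10 : 1 + c != 0.
  by apply: contra c1 => /eqP h; apply/eqP; lra.
have tE : t * (1 + c) = - s by rewrite /t mulNr divfK.
have st : 1 + s * t = c.
  apply: (mulIf c10); rewrite mulrDl mul1r -mulrA tE.
  by move: cs; nra.
have tt : 2 * t + s * t ^+ 2 = - s by rewrite -tE -st; ring.
split; first by rewrite -[in LHS]st -[s in - (s * y)]opprK -[in LHS]tt; ring.
by rewrite -[in LHS]st; ring.
Qed.

Lemma preserves_translate1 (f : R -> R) : measurable_fun setT f ->
  preserves mu2 (fun z : R * R => (z.1 + f z.2, z.2)).
Proof.
move=> mf; apply: (@preserves_shear1 _ _ _ _ _ mu mu (fun x y => x + f y)).
  by apply: measurable_funD => //; apply: measurableT_comp.
by move=> y A mA; exact: lebesgue_measure_translation.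
Qed.

Lemma preserves_translate2 (f : R -> R) : measurable_fun setT f ->
  preserves mu2 (fun z : R * R => (z.1, z.2 + f z.1)).
Proof.
move=> mf; apply: (@preserves_shear2 _ _ _ _ _ mu mu (fun x y => y + f x)).
  by apply: measurable_funD => //; apply: measurableT_comp.
by move=> y A mA; exact: lebesgue_measure_translation.
Qed.

Lemma preserves_rotation2 (c s : R) : c ^+ 2 + s ^+ 2 = 1 ->
  preserves mu2 (rotation2 c s).
Proof.
move: c s; apply: (@preserves_rotation _ _ mu2
    (fun t z => (z.1 + t * z.2, z.2)) (fun t z => (z.1, z.2 + t * z.1)) rotation2).
- by move=> t; apply: preserves_translate1; apply: measurable_funM.
- by move=> t; apply: preserves_translate2; apply: measurable_funM.
- move=> c s c1 cs; apply/funext => -[x y]; rewrite /rotation2/=.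
  by have [-> ->] := shear_sum x y c1 cs.
- by apply/funext => -[x y]; rewrite /rotation2/=; congr pair; ring.
Qed.

(* The sigma-finite structure of a product measure is inferred only for
   subprobabilities. *)
Definition plane_measure : {sigma_finite_measure
    set (measurableTypeR R * measurableTypeR R)%type -> \bar R} :=
  HB.pack (mu \x mu)%E (Measure_isSigmaFinite.Build _ _ R (mu \x mu)%E
    (sigma_finite_product mu mu)).

Definition rotation_xz (c s : R) (z : R * R * R) : R * R * R :=
  (c * z.1.1 - s * z.2, z.1.2, s * z.1.1 + c * z.2).

Definition rotation_yz (c s : R) (z : R * R * R) : R * R * R :=
  (z.1.1, c * z.1.2 - s * z.2, s * z.1.2 + c * z.2).

Let m1 : measurable_fun setT (fun z : R * R * R => z.1.1).
Proof. exact: (measurableT_comp measurable_fst measurable_fst). Qed.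

Let m2 : measurable_fun setT (fun z : R * R * R => z.1.2).
Proof. exact: (measurableT_comp measurable_snd measurable_fst). Qed.

Lemma preserves_rotation_xz (c s : R) : c ^+ 2 + s ^+ 2 = 1 ->
  preserves mu3 (rotation_xz c s).
Proof.
move: c s; apply: (@preserves_rotation _ _ mu3
    (fun t z => (z.1.1 + t * z.2, z.1.2, z.2))
    (fun t z => (z.1, z.2 + t * z.1.1)) rotation_xz).
- move=> t; apply: (@preserves_shear1 _ _ _ _ _ plane_measure mu
      (fun u z => (u.1 + t * z, u.2))) => [|z A mA].
    apply: measurable_fun_pair => //.
    by apply: measurable_funD => //; apply: measurable_funM.
  exact: (proj2 (preserves_translate1 (measurable_cst (t * z))) A mA).
- move=> t; apply: (@preserves_shear2 _ _ _ _ _ plane_measure mu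
      (fun u z => z + t * u.1)) => [|u A mA].
    by apply: measurable_funD => //; apply: measurable_funM.
  exact: lebesgue_measure_translation.
- move=> c s c1 cs; apply/funext => -[[x y] z]; rewrite /rotation_xz/=.
  by have [-> ->] := shear_sum x z c1 cs.
- by apply/funext => -[[x y] z]; rewrite /rotation_xz/=; congr (_, _, _); ring.
Qed.

Lemma preserves_rotation_yz (c s : R) : c ^+ 2 + s ^+ 2 = 1 ->
  preserves mu3 (rotation_yz c s).
Proof.
move: c s; apply: (@preserves_rotation _ _ mu3
    (fun t z => (z.1.1, z.1.2 + t * z.2, z.2))
    (fun t z => (z.1, z.2 + t * z.1.2)) rotation_yz).
- move=> t; apply: (@preserves_shear1 _ _ _ _ _ plane_measure mu
      (fun u z => (u.1, u.2 + t * z))) => [|z A mA].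
    apply: measurable_fun_pair => //.
    by apply: measurable_funD => //; apply: measurable_funM.
  exact: (proj2 (preserves_translate2 (measurable_cst (t * z))) A mA).
- move=> t; apply: (@preserves_shear2 _ _ _ _ _ plane_measure mu
      (fun u z => z + t * u.2)) => [|u A mA].
    by apply: measurable_funD => //; apply: measurable_funM.
  exact: lebesgue_measure_translation.
- move=> c s c1 cs; apply/funext => -[[x y] z]; rewrite /rotation_yz/=.
  by have [-> ->] := shear_sum y z c1 cs.
- by apply/funext => -[[x y] z]; rewrite /rotation_yz/=; congr (_, _, _); ring.
Qed.

End rotations.

(** * Moments of a direction on the circle *)

Section circle.
Context {R : realType}.
Notation mu := (@lebesgue_measure R).

(** The integrand is |r sin (al - w)|. Up to a global sign [p] is nonnegative, which puts the phase
    [al] in [0, pi], the range of [acos]; then [al] is the only point where the sign can change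
    inside the interval, and r cos (al - w), up to sign, is a primitive on either side. *)
Lemma integral_abs_sinusoid (p q : R) :
  (\int[mu]_(w in `[0%R, pi]) `|p * cos w + q * sin w|%:E =
   (2 * Num.sqrt (p ^+ 2 + q ^+ 2))%:E)%E.
Proof.
wlog p0 : p q / 0 <= p => [H|].
  case: (leP 0 p) => [/H //|p0]; have {H} := H (- p) (- q).
  rewrite oppr_ge0 (ltW p0) !sqrrN => <- //.
  by apply: eq_integral => w _; rewrite !mulNr -opprD normrN.
set r := Num.sqrt _.
have r0 : 0 <= r by exact: sqrtr_ge0.
have r2 : r ^+ 2 = p ^+ 2 + q ^+ 2 by rewrite sqr_sqrtr// addr_ge0// sqr_ge0.
have pi0 : 0 < (pi : R) := pi_gt0 R.
have [al [al0 alpi rc rs]] :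
    exists al, [/\ 0 <= al, al <= pi, r * cos al = - q & r * sin al = p].
  have [r00|rn0] := eqVneq r 0.
    exists 0; rewrite r00 !mul0r lexx ltW//.
    move: r2; rewrite r00 expr0n/= => /esym/eqP.
    by rewrite paddr_eq0 ?sqr_ge0// !sqrf_eq0 => /andP[/eqP -> /eqP ->]; rewrite oppr0.
  have rp : 0 < r by rewrite lt_def rn0.
  have qr : -1 <= - q / r <= 1.
    by rewrite ler_pdivlMr// ler_pdivrMr// mulN1r mul1r; apply/andP; split; nra.
  exists (acos (- q / r)); split.
  - exact: acos_ge0.
  - exact: acos_lepi.
  - by rewrite acosK// mulrC divfK.
  - rewrite sin_acos//.
    rewrite -[X in X * _](ger0_norm r0) -sqrtr_sqr -sqrtrM ?sqr_ge0//.
    rewrite (_ : _ * _ = p ^+ 2) ?sqrtr_sqr ?ger0_norm//.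
    by rewrite mulrBr mulr1 -exprMn [r * _]mulrC divfK// sqrrN r2 addrK.
pose f (w : R) := r * sin (al - w).
have fE w : p * cos w + q * sin w = f w.
  by rewrite /f sinB mulrBr !mulrA rs rc; ring.
under eq_integral do rewrite fE.
have dF (w : R) : is_derive w 1 (fun w => r * cos (al - w)) (f w).
  by apply: is_derive_eq; rewrite /GRing.scale/= /f; ring.
have dG (w : R) : is_derive w 1 (fun w => - (r * cos (al - w))) (- f w).
  by apply: is_derive_eq; rewrite /GRing.scale/= /f; ring.
have cf : continuous f.
  apply: (@continuous_is_derive _ _ (fun w => - (r * cos (al - w)))) => w.
  by apply: is_derive_eq; rewrite /GRing.scale/= /f; ring.
have mf : measurable_fun setT (fun w => `|f w|%:E : \bar R).
  by apply/measurable_EFinP/measurableT_comp => //; exact: continuous_measurable_fun.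
rewrite (@itv_bndbnd_setU _ _ _ (BLeft al)) ?bnd_simp// ge0_integral_setU//=.
- rewrite integral_itv_bndo_bndc; last exact: measurable_funTS.
  rewrite (_ : 2 * r = (r * cos (al - al) - r * cos (al - 0)) +
      (- (r * cos (al - pi)) - - (r * cos (al - al)))); last first.
    by rewrite subrr subr0 cos0 cosB cospi sinpi; ring.
  rewrite EFinD -(integral_is_derive al0 cf dF) -(integral_is_derive alpi _ dG).
    congr (_ + _)%E; apply: eq_integral => w; rewrite inE/= in_itv/= => /andP[w0 w1].
      by rewrite ger0_norm// mulr_ge0// sin_ge0_pi//; lra.
    rewrite ler0_norm// mulr_ge0_le0//.
    by rewrite -oppr_ge0 -sinN sin_ge0_pi//; lra.
  by move=> w; apply: cvgN; exact: cf.
- exact: measurable_funTS.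
- rewrite disj_set2E; apply/eqP; rewrite -subset0 => w [] /=.
  by rewrite !in_itv/= => /andP[_ wal] /andP[+ _]; rewrite leNgt wal.
Qed.

Lemma integral_sqr_sinusoid (p q : R) :
  (\int[mu]_(w in `[0%R, pi]) ((p * cos w + q * sin w) ^+ 2)%:E =
   (pi / 2 * (p ^+ 2 + q ^+ 2))%:E)%E.
Proof.
(* A primitive of the double-angle form (p^2 + q^2)/2 + (p^2 - q^2)/2 cos 2w + p q sin 2w. *)
pose F (w : R) := (p ^+ 2 + q ^+ 2) / 2 * w
  + (p ^+ 2 - q ^+ 2) / 2 * (sin w * cos w) + p * q * (sin w) ^+ 2.
pose f (w : R) := (p * cos w + q * sin w) ^+ 2.
have dF (w : R) : is_derive w 1 F (f w).
  apply: is_derive_eq; rewrite /GRing.scale/= /f.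
  by have := cos2Dsin2 w; move: (cos w) (sin w) => c s; nra.
have cf : continuous f.
  apply: (@continuous_is_derive _ _ (fun w =>
    2 * (p * cos w + q * sin w) * (q * cos w - p * sin w))) => w.
  by apply: is_derive_eq; rewrite /GRing.scale/=; ring.
rewrite (integral_is_derive (pi_ge0 R) cf dF) /F sinpi sin0.
by congr EFin; field.
Qed.

Definition circle_dir (i : 'I_2) (w : measurableTypeR R) : R :=
  if i == 0 then cos w else sin w.

End circle.

(** * Projections of the planar spherical density *)

Section disc_projection.
Context {R : realType}.
Notation mu := (@lebesgue_measure R).
Notation mu2 := (mu \x mu)%E.

(** On the chord |y| < s with s^2 = 1 - x^2 the density is 1 / (2 pi sqrt (s^2 - y^2)), and the
    arcsine integral equals pi whatever the half-length [s]: this is why the marginal is uniform. *)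
Lemma disc_pdf_marginal (x : R) : -1 < x < 1 ->
  (\int[mu]_y (disc_pdf (x, y))%:E = (2^-1)%:E)%E.
Proof.
move=> x1; pose s := Num.sqrt (1 - x ^+ 2).
have x2 : 0 < 1 - x ^+ 2 by case/andP: x1 => *; nra.
have s0 : 0 < s by rewrite sqrtr_gt0.
have s2 : s ^+ 2 = 1 - x ^+ 2 by rewrite sqr_sqrtr// ltW.
transitivity (\int[mu]_(y in `](- s)%R, s[)
    (((2 * pi)^-1)%:E * (Num.sqrt (s ^+ 2 - y ^+ 2))^-1%:E))%E; last first.
  rewrite ge0_integralZl//.
  - rewrite integral_arcsine// -EFinM; congr EFin.
    by rewrite invfM divfK// gt_eqF// pi_gt0.
  - apply/measurable_funTS/measurable_EFinP/measurable_fun_invr.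
      by move=> y; exact: sqrtr_ge0.
    by apply: measurable_fun_sqrt; exact: measurable_funB.
  - by rewrite lee_fin invr_ge0 mulr_ge0// pi_ge0.
rewrite [RHS]integral_mkcond; apply: eq_integral => y _.
rewrite patchE mem_setE in_itv/= /disc_pdf/=.
rewrite (_ : (x ^+ 2 + y ^+ 2 < 1) = (- s < y < s)).
  by case: ifP => // _; rewrite s2 invfM EFinM.
rewrite -ltr_norml -[in RHS](@ltr_pXn2r _ 2)// ?nnegrE ?ltW//.
by rewrite real_normK ?num_real// s2 ltrBrDl.
Qed.

Lemma disc_pdf_out (x y : R) : ~~ (-1 < x < 1) -> disc_pdf (x, y) = 0.
Proof.
move=> x1; rewrite /disc_pdf/=; case: ifP => // xy.
case/negP: x1; have := sqr_ge0 y; have := sqr_ge0 x => *.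
by apply/andP; split; nra.
Qed.

Lemma disc_prob_le (t : R) :
  disc_prob [set z : R * R | z.1 <= t] = (unif_cdf t)%:E.
Proof.
have mpdf : measurable_fun setT (fun z : R * R => (disc_pdf z)%:E : \bar R).
  by apply/measurable_EFinP; exact: measurable_disc_pdf.
have mt : measurable [set z : R * R | z.1 <= t].
  rewrite -[X in measurable X]setTI.
  by apply: (measurable_fun_ler _ (measurable_cst t) measurableT (Y := [set true])).
rewrite /disc_prob integral_mkcond fubini_tonelli1/=; last 2 first.
- by apply/(measurable_restrictT _ mt)/measurable_funTS.
- by move=> z; rewrite patchE; case: ifP => //; rewrite lee_fin disc_pdf_ge0.
pose D : set R := `]-1, 1[ `&` `]-oo, t].
transitivity (\int[mu]_(x in D) (2^-1 : R)%:E)%E.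
  rewrite [RHS]integral_mkcond; apply: eq_integral => x _.
  rewrite patchE /D in_setI !mem_setE !in_itv/= /fubini_F.
  transitivity (\int[mu]_y (if (x <= t)%R then (disc_pdf (x, y))%:E else 0))%E.
    by apply: eq_integral => y _; rewrite patchE mem_setE.
  have [xt|xt] := leP x t; last first.
    by rewrite andbF integral0_eq.
  rewrite andbT; case: ifPn => x1; first exact: disc_pdf_marginal.
  by rewrite integral0_eq// => y _; rewrite disc_pdf_out.
rewrite integral_cst//; last exact: measurableI.
rewrite /unif_cdf; case: ltP => t1.
  rewrite (_ : D = set0) ?measure0 ?mule0//.
  by apply/seteqP; split => // x []/=; rewrite !in_itv/= => *; lra.
case: ltP => t2.
  rewrite (_ : D = `]-1, t]%classic); last first.
    apply/seteqP; split => x; rewrite /D/= !in_itv/=.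
      by move=> [/andP[-> _] ->].
    by move=> /andP[-> xt]; split=> //=; lra.
  rewrite [X in (_ * X)%E]lebesgue_measure_itv/= lte_fin.
  case: ltP => t3; rewrite ?mule0.
    by rewrite -EFinB -EFinM; congr EFin; field.
  by congr EFin; lra.
rewrite (_ : D = `]-1, 1[%classic); last first.
  apply/seteqP; split => x; rewrite /D/= !in_itv/=; first by case.
  by move=> /andP[-> x1]; split; [rewrite x1|lra].
rewrite [X in (_ * X)%E]lebesgue_measure_itv/= lte_fin ifT; last lra.
by rewrite -EFinB -EFinM; congr EFin; field.
Qed.

Lemma disc_prob_proj_le (c s t : R) : c ^+ 2 + s ^+ 2 = 1 ->
  disc_prob [set z : R * R | c * z.1 + s * z.2 <= t] = (unif_cdf t)%:E.
Proof.
move=> cs; rewrite -disc_prob_le /disc_prob.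
have mpdf : measurable_fun setT (fun z : R * R => (disc_pdf z)%:E : \bar R).
  by apply/measurable_EFinP; exact: measurable_disc_pdf.
have mt : measurable [set z : R * R | z.1 <= t].
  rewrite -[X in measurable X]setTI.
  by apply: (measurable_fun_ler _ (measurable_cst t) measurableT (Y := [set true])).
rewrite integral_mkcond [RHS]integral_mkcond.
pose h := (fun z : R * R => (disc_pdf z)%:E : \bar R) \_ [set z | z.1 <= t].
have mh : measurable_fun setT h.
  by apply/(measurable_restrictT _ mt)/measurable_funTS.
have h0 z : (0 <= h z)%E.
  by rewrite /h patchE; case: ifP => //; rewrite lee_fin disc_pdf_ge0.
(* This rotation has c z.1 + s z.2 as its first coordinate, and [disc_pdf] only depends on the
   norm. *)
have p : preserves mu2 (rotation2 c (- s)).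
  by apply: preserves_rotation2; rewrite sqrrN.
rewrite -[RHS](preserves_integral p mh h0); apply: eq_integral => -[x y] _.
rewrite /h !patchE /rotation2 mulNr opprK.
have -> : ((x, y) \in [set z : R * R | c * z.1 + s * z.2 <= t]) =
  (c * x + s * y <= t) by rewrite mem_setE.
have -> : ((c * x + s * y, - s * x + c * y) \in [set z : R * R | z.1 <= t]) =
  (c * x + s * y <= t) by rewrite mem_setE.
case: ifP => // _; congr EFin; rewrite /disc_pdf/=.
have e : (c * x + s * y) ^+ 2 + (- s * x + c * y) ^+ 2 = x ^+ 2 + y ^+ 2.
  by rewrite -[RHS]mul1r -cs; ring.
by rewrite e -!addrA -!opprD e.
Qed.

End disc_projection.

(** * The planar case *)

Section dimension2.
Context {R : realType}.
Notation mu := (@lebesgue_measure R).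

(** Half of the circle is enough: opposite directions give the same absolute value and the same
    square. *)
Let tau : probability (measurableTypeR R) R := uniform_prob (pi_gt0 R).

Let measurable_circle_dir i : measurable_fun setT (@circle_dir R i).
Proof.
rewrite /circle_dir; case: (i == 0).
  by apply: continuous_measurable_fun; exact: continuous_cos.
by apply: continuous_measurable_fun; exact: continuous_sin.
Qed.

Let sum2E (F : 'I_2 -> R) : \sum_(i < 2) F i = F 0 + F 1.
Proof.
rewrite !big_ord_recl big_ord0 addr0.
by have -> : lift ord0 ord0 = 1 :> 'I_2 by exact/val_inj.
Qed.

Let sum_circle_dir (v : 'I_2 -> R) (w : R) :
  \sum_(i < 2) circle_dir i w * v i = v 0 * cos w + v 1 * sin w.
Proof. by rewrite sum2E; congr (_ + _); exact: mulrC. Qed.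

Let pi_neq0 : (pi : R) != 0. Proof. exact: lt0r_neq0 (pi_gt0 R). Qed.

Let circle_abs_moment (v : 'I_2 -> R) :
  (\int[tau]_w `|\sum_(i < 2) circle_dir i w * v i|%:E =
   (2 / pi * Num.sqrt (\sum_(i < 2) v i ^+ 2))%:E)%E.
Proof.
rewrite integral_uniform//; last first.
  apply/measurable_EFinP; apply: measurableT_comp => //; apply: measurable_sum => i.
  exact: measurable_funM.
under eq_integral do rewrite sum_circle_dir.
rewrite integral_abs_sinusoid subr0 -EFinM sum2E.
by congr EFin; rewrite [2 / pi]mulrC mulrA.
Qed.

Let circle_sqr_moment (v : 'I_2 -> R) :
  (\int[tau]_w ((\sum_(i < 2) circle_dir i w * v i) ^+ 2)%:E =
   (2%:R^-1 * \sum_(i < 2) v i ^+ 2)%:E)%E.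
Proof.
rewrite integral_uniform//; last 2 first.
- apply/measurable_EFinP; apply: measurable_funX; apply: measurable_sum => i.
  exact: measurable_funM.
- by move=> w; rewrite lee_fin sqr_ge0.
under eq_integral do rewrite sum_circle_dir.
rewrite integral_sqr_sinusoid subr0 -EFinM sum2E.
by congr EFin; rewrite !mulrA mulVf// mul1r.
Qed.

Lemma spherical_copula2_proj_le (w : measurableTypeR R) (t : R) :
  spherical_copula2 R [set x | dir_proj circle_dir w x <= t] = (unif_cdf t)%:E.
Proof.
have projE z : dir_proj circle_dir w (to_unit_cube (pair_tuple z)) =
    cos w * z.1 + sin w * z.2.
  rewrite /dir_proj sum2E /to_unit_cube !tnth_mktuple !(tnth_nth 0)/=.
  by rewrite /circle_dir/=; field.
rewrite -(disc_prob_proj_le t (cos2Dsin2 w)).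
transitivity (disc_prob
  [set z : R * R | dir_proj circle_dir w (to_unit_cube (pair_tuple z)) <= t]) => //.
by congr (disc_prob _); apply/funext => z /=; rewrite projE.
Qed.

Let slope_gt0 : 0 < 2 / (pi : R). Proof. by rewrite divr_gt0// pi_gt0. Qed.

Let slopeE : (3 * (2 / (pi : R)))^-1 = pi / 6.
Proof. by rewrite mulrA invfM invrK mulrC; congr (_ * _^-1); ring. Qed.

Lemma mean_dist_spherical_copula2 :
  mean_dist (spherical_copula2 R) (spherical_copula2 R) = (pi / 6)%:E.
Proof.
rewrite -slopeE.
apply: (mean_dist_unif_proj measurable_circle_dir slope_gt0 circle_abs_moment).
by apply: aeW => w t; exact: spherical_copula2_proj_le.
Qed.

Lemma mean_dist_copula2_le (C : probability (2.-tuple R) R) : is_copula C ->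
  (mean_dist C C <= (pi / 6)%:E)%E.
Proof.
move=> Ccop; rewrite -slopeE.
exact: (mean_dist_copula_le measurable_circle_dir slope_gt0 circle_abs_moment
  circle_sqr_moment).
Qed.

End dimension2.

(** * Volumes of the ball and of its cones by slicing *)

Section caps.
Context {R : realType}.
Notation mu := (@lebesgue_measure R).
Notation mu2 := (mu \x mu)%E.
Notation mu3 := (mu \x mu \x mu)%E.

(** The parameter is the squared radius, possibly negative, so that slices of cones and balls have a
    parameter polynomial in the height. *)
Definition disc (s : R) : set (R * R) := [set z | z.1 ^+ 2 + z.2 ^+ 2 <= s].

Lemma measurable_disc s : measurable (disc s).
Proof.
rewrite -[X in measurable X]setTI.
apply: (measurable_fun_ler _ (measurable_cst s) measurableT (Y := [set true])) => //.
by apply: measurable_funD; apply: measurable_funX.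
Qed.

(** One-dimensional scaling in each factor settles rectangles, and rectangles determine the product
    measure. *)
Lemma lebesgue_measure2_scale (k : R) (X : set (R * R)) : 0 < k -> measurable X ->
  (mu2 X = (k ^+ 2)%:E *
    mu2 ((fun z : R * R => (k * z.1, k * z.2)%R) @^-1` X))%E.
Proof.
move=> k0 mX; have k20 : 0 <= k ^+ 2 := sqr_ge0 k.
pose f (z : measurableTypeR R * measurableTypeR R) :
  measurableTypeR R * measurableTypeR R := (k * z.1, k * z.2).
have mf : measurable_fun setT f.
  by apply: measurable_fun_pair; apply: measurable_funM.
pose m := mscale (NngNum k20) (pushforward mu2 f).
transitivity (m mf X) => //.
apply: (@product_measure_unique _ _ _ _ _ mu mu (m mf)) => // Y Z mY mZ.
transitivity ((k ^+ 2)%:E * mu2 (f @^-1` (Y `*` Z)))%E => //.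
have sc (W : set R) : measurable W -> measurable (( *%R k) @^-1` W).
  move=> mW; rewrite -[X in measurable X]setTI.
  by have mk : measurable_fun setT (fun x : R => k * x);
    [apply: measurable_funM|exact: mk].
have muE (W : set R) : measurable W -> (mu W = k%:E * mu (( *%R k) @^-1` W))%E.
  move=> mW; rewrite (lebesgue_measure_affine 0 k0 mW).
  by congr (_ * mu _)%E; apply/funext => x /=; rewrite addr0.
rewrite (_ : f @^-1` (Y `*` Z) = (( *%R k) @^-1` Y) `*` (( *%R k) @^-1` Z))//.
rewrite [X in (_ * X)%E]product_measure1E; try exact: sc.
rewrite expr2 EFinM muleACA.
by congr (_ * _)%E; exact/esym/muE.
Qed.

Lemma area_disc (s : R) : mu2 (disc s) = ((Num.max s 0)%:E * mu2 (disc 1))%E.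
Proof.
have [s0|s0|->] := ltgtP s 0.
- rewrite mul0e (_ : disc s = set0) ?measure0//.
  apply/seteqP; split => // -[x y]; rewrite /disc/=.
  by have := sqr_ge0 x; have := sqr_ge0 y => *; lra.
- have r0 : 0 < Num.sqrt s by rewrite sqrtr_gt0.
  rewrite (lebesgue_measure2_scale r0 (measurable_disc s)) sqr_sqrtr ?ltW//.
  congr (_ * mu2 _)%E; apply/funext => -[x y]; rewrite /disc/=.
  by rewrite !exprMn sqr_sqrtr ?(ltW s0)// -mulrDr ger_pMr.
- rewrite mul0e (_ : disc 0 = [set 0] `*` [set 0]).
    by rewrite [LHS]product_measure1E// [X in (X * _)%E]lebesgue_measure_set1 mul0e.
  apply/seteqP; split => -[x y]; rewrite /disc/=.
    have := sqr_ge0 x; have := sqr_ge0 y => y0 x0 xy.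
    by split; apply/eqP; rewrite -sqrf_eq0; apply/eqP; lra.
  by move=> [-> ->]; rewrite !expr0n/= addr0.
Qed.

Lemma eucl_norm_triple (z : R * R * R) : eucl_norm (triple_tuple z) =
  Num.sqrt (z.1.1 ^+ 2 + z.1.2 ^+ 2 + z.2 ^+ 2).
Proof.
by rewrite /eucl_norm !big_ord_recr big_ord0/= add0r !(tnth_nth 0).
Qed.

Lemma measurable_eucl_norm_triple :
  measurable_fun setT (fun z : R * R * R => eucl_norm (triple_tuple z)).
Proof.
apply: (measurableT_comp (@measurable_eucl_norm R 3)).
exact: measurable_triple_tuple.
Qed.

(** A solid cone: the points of the ball whose radial projection lies in the spherical cap of height
    at least [t]. *)
Definition cap (t : R) : set (R * R * R) :=
  punctured_ball `&` [set z | t * eucl_norm (triple_tuple z) <= z.2].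

Lemma measurable_cap t : measurable (cap t).
Proof.
apply: measurableI; first exact: measurable_punctured_ball.
rewrite -[X in measurable X]setTI.
apply: (measurable_fun_ler _ _ measurableT (Y := [set true])) => //.
by apply: measurable_funM => //; exact: measurable_eucl_norm_triple.
Qed.

(** Positivity allows squaring the cone condition. The sphere bounds the squared radius by 1 - h^2,
    the cone by (t^-2 - 1) h^2. *)
Let ysection_cap (t h : R) : 0 < t -> 0 < h ->
  ysection (cap t) h = disc (Num.min (1 - h ^+ 2) ((t ^- 2 - 1) * h ^+ 2)).
Proof.
move=> t0 h0; apply/funext => -[x y].
rewrite /ysection/= inE /cap /punctured_ball /disc/= eucl_norm_triple/=.
set n := Num.sqrt _.
have N0 : 0 < x ^+ 2 + y ^+ 2 + h ^+ 2.
  by have := sqr_ge0 x; have := sqr_ge0 y; have := exprn_gt0 2 h0 => *; lra.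
have n0 : 0 < n by rewrite sqrtr_gt0.
have n2 : n ^+ 2 = x ^+ 2 + y ^+ 2 + h ^+ 2 by rewrite sqr_sqrtr// ltW.
have t20 : 0 < t ^+ 2 by rewrite exprn_gt0.
have n1 : (n <= 1) = (n ^+ 2 <= 1) by rewrite expr_le1// ltW.
have tn : (t * n <= h) = ((t * n) ^+ 2 <= h ^+ 2).
  by rewrite ler_sqr// nnegrE ltW// mulr_gt0.
rewrite n0 n1 tn/= exprMn n2 -ler_pdivlMl// le_min mulrBl mul1r !lerBrDr.
by apply/propext; split => [[-> ->] //|/andP[]].
Qed.

Let ysection_cap0 (t h : R) : 0 < t -> h <= 0 -> ysection (cap t) h = set0.
Proof.
move=> t0 h0; apply/seteqP; split => // -[x y].
rewrite /ysection/= inE /cap /punctured_ball/= => -[/andP[n0 _]].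
by rewrite leNgt (le_lt_trans h0)// mulr_gt0.
Qed.

(* The area of the unit disc need not be known: it cancels out in ball_prob. *)
Lemma volume_cap (t : R) : 0 < t <= 1 ->
  mu3 (cap t) = ((2 / 3 * (1 - t))%:E * mu2 (disc 1))%E.
Proof.
move=> /andP[t0 t1].
rewrite [LHS](product_measure12 plane_measure mu (measurable_cap t)).
pose q := t ^- 2 - 1.
have q0 : 0 <= q by rewrite subr_ge0 invf_ge1 ?exprn_gt0// exprn_ile1// ltW.
(* The two bounds on the squared radius cross at h = t: the cone is the tighter one below, the
   sphere above. *)
pose g h : R := if 0 <= h < t then q * h ^+ 2 + 0 * h + 0
  else if t <= h < 1 then -1 * h ^+ 2 + 0 * h + 1 else 0.
have g1 (h : R) : 0 <= h < t -> 0 <= q * h ^+ 2 + 0 * h + 0.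
  by move=> _; rewrite mul0r !addr0 mulr_ge0// sqr_ge0.
have g2 (h : R) : t <= h < 1 -> 0 <= -1 * h ^+ 2 + 0 * h + 1.
  by move=> /andP[? ?]; nra.
transitivity (\int[mu]_h ((g h)%:E * mu2 (disc 1)))%E.
  apply: eq_integral => h _; have [h0|h0] := leP h 0.
    rewrite ysection_cap0// measure0 /g.
    have [h00|h00] := leP 0 h; last by rewrite leNgt (lt_trans h00 t0)/= mul0e.
    have -> : h = 0 by apply/eqP; rewrite eq_le h0.
    by rewrite t0 expr0n/= !mulr0 !addr0 mul0e.
  rewrite ysection_cap// [LHS]area_disc; congr (_%:E * _)%E.
  rewrite /g (ltW h0)/=; have h20 : 0 < h ^+ 2 by rewrite exprn_gt0.
  have tE : (t ^- 2 * h ^+ 2 < 1) = (h < t).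
    rewrite mulrC ltr_pdivrMr ?exprn_gt0// mul1r ltr_pXn2r// nnegrE ltW//.
  have qE : q * h ^+ 2 = t ^- 2 * h ^+ 2 - h ^+ 2 by rewrite mulrBl mul1r.
  have [ht|ht] := ltP h t.
    move: tE; rewrite ht => tE; rewrite mul0r !addr0.
    rewrite (@max_l _ _ (Num.min _ _)) ?min_r//; first by rewrite qE; lra.
      by rewrite mulr_ge0// ltW.
    by rewrite qE; lra.
  move: tE; rewrite [h < t]ltNge ht => /negbT; rewrite -leNgt => tE.
  rewrite min_l; last by rewrite qE; lra.
  have [h1|h1] := ltP h 1.
    by rewrite max_l; [ring|rewrite subr_ge0 expr_le1// ltW].
  by rewrite max_r// subr_le0 expr_ge1// ltW.
rewrite ge0_integralZr//.
(* The pieces are (t - t^3)/3 and 2/3 - t + t^3/3; the cubic terms cancel, and the linearity in [t]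
   that remains is Archimedes' theorem. *)
- rewrite integral_two_quadratics//; last exact: ltW.
  congr (_%:E * _)%E; rewrite /q; field.
  by rewrite gt_eqF.
- by apply/measurable_EFinP; exact: measurable_two_quadratics.
- move=> h _; rewrite lee_fin /g; case: ifPn => [|_]; first exact: g1.
  by case: ifPn => [|_] //; exact: g2.
Qed.

Let sqrt_le1 (u : R) : (Num.sqrt u <= 1) = (u <= 1).
Proof. by rewrite -{1}(@sqrtr1 R) ler_sqrt. Qed.

Lemma volume_punctured_ball :
  mu3 punctured_ball = ((4 / 3)%:E * mu2 (disc 1))%E.
Proof.
have mB := @measurable_punctured_ball R.
rewrite [LHS](product_measure12 plane_measure mu mB).
pose g (h : R) : R := if -1 <= h < 1 then -1 * h ^+ 2 + 0 * h + 1
  else if 1 <= h < 1 then 0 * h ^+ 2 + 0 * h + 0 else 0.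
have g1 (h : R) : -1 <= h < 1 -> 0 <= -1 * h ^+ 2 + 0 * h + 1.
  by move=> /andP[? ?]; nra.
have g2 (h : R) : 1 <= h < 1 -> 0 <= 0 * h ^+ 2 + 0 * h + 0.
  by move=> _; rewrite !mul0r !addr0.
transitivity (\int[mu]_h ((g h)%:E * mu2 (disc 1)))%E.
  apply: eq_integral => h _; have [->|h0] := eqVneq h 0.
    rewrite (_ : g 0 = 1); last by rewrite /g ifT; [ring|lra].
    rewrite mul1e; have mS : measurable (ysection (@punctured_ball R) 0).
      exact: measurable_ysection.
    (* The slice at height 0 misses the origin; [disc 0] restores it at no cost in area. *)
    rewrite (_ : disc 1 = ysection (@punctured_ball R) 0 `|` disc 0).
      rewrite [RHS]measureU//.
      - by rewrite [X in (_ + X)%E]area_disc maxxx mul0e adde0.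
      - exact: measurable_disc.
      - apply/seteqP; split => // -[x y].
        rewrite /ysection/= inE /punctured_ball /disc/= eucl_norm_triple/=.
        by rewrite sqrtr_gt0 expr0n/= addr0 => -[/andP[+ _]]; rewrite ltNge => /negP.
    apply/funext => -[x y].
    rewrite /setU /ysection/= inE /punctured_ball /disc/= eucl_norm_triple/=.
    rewrite sqrtr_gt0 expr0n/= addr0 sqrt_le1.
    apply/propext; split => [xy|[/andP[]//|]]; last by move=> /le_trans; apply.
    by have [?|?] := ltP 0 (x ^+ 2 + y ^+ 2); [left|right].
  rewrite (_ : ysection _ _ = disc (1 - h ^+ 2)).
    rewrite [LHS]area_disc; congr (_%:E * _)%E; rewrite /g.
    have [h1|h1] := boolP (-1 <= h < 1).
      by rewrite max_l; [ring|have := g1 h h1; lra].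
    rewrite max_r; last first.
      rewrite subr_le0; move: h1; rewrite negb_and -!ltNge -leNgt => /orP[|] ?; nra.
    by case: ifP => // _; ring.
  apply/funext => -[x y].
  rewrite /ysection/= inE /punctured_ball /disc/= eucl_norm_triple/=.
  have N0 : 0 < x ^+ 2 + y ^+ 2 + h ^+ 2.
    have := sqr_ge0 x; have := sqr_ge0 y.
    have : 0 < h ^+ 2 by rewrite exprn_even_gt0.
    by move=> *; lra.
  by rewrite sqrtr_gt0 N0/= sqrt_le1 lerBrDr.
rewrite ge0_integralZr//.
- rewrite integral_two_quadratics//.
  by congr (_%:E * _)%E; field.
- by apply/measurable_EFinP; exact: measurable_two_quadratics.
- move=> h _; rewrite lee_fin /g; case: ifPn => [|_]; first exact: g1.
  by case: ifPn => [|_] //; exact: g2.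
Qed.

End caps.

(** * Cones around an arbitrary axis *)

Section ball.
Context {R : realType}.
Notation mu := (@lebesgue_measure R).
Notation mu2 := (mu \x mu)%E.
Notation mu3 := (mu \x mu \x mu)%E.

Lemma ball_prob_cap (t : R) : 0 < t <= 1 ->
  ball_prob [set z : R * R * R | t * eucl_norm (triple_tuple z) <= z.2] =
  ((1 - t) / 2)%:E.
Proof.
move=> t01; rewrite /ball_prob setIC -/(cap t) (volume_cap t01).
(* Total mass 1 rules out the values 0 and +oo for the area of the unit disc: with the default
   inverse 0, the product would be 0. *)
have : ((fine (mu3 punctured_ball))^-1%:E * mu3 (setT `&` punctured_ball) = 1)%E.
  exact: (probability_setT (@ball_prob R)).
rewrite setTI volume_punctured_ball.
have : (0 <= mu2 (disc (1 : R)))%E by exact: measure_ge0.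
move: (mu2 (disc 1)) => [a| |] a0 //.
- rewrite -!EFinM/= => -[/eqP]; rewrite -[X in _ == X](divff (oner_neq0 R)).
  have [->|a_neq0] := eqVneq a 0.
    by rewrite !mulr0 divr1 => /eqP/esym/eqP; rewrite oner_eq0.
  by move=> _; congr EFin; field; rewrite a_neq0.
- rewrite gt0_muley/= ?lte_fin ?divr_gt0// invr0 mul0e => -[/eqP].
  by rewrite eq_sym oner_eq0.
Qed.

(** A rotation in the yz plane takes (a, b, c) to (a, 0, r), and one in the xz plane takes this to
    (0, 0, 1). *)
Lemma rotation_to_z (a b c : R) : a ^+ 2 + b ^+ 2 + c ^+ 2 = 1 ->
  exists psi : R * R * R -> R * R * R, [/\ preserves mu3 psi,
    forall z, eucl_norm (triple_tuple (psi z)) = eucl_norm (triple_tuple z) &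
    forall z, (psi z).2 = a * z.1.1 + b * z.1.2 + c * z.2].
Proof.
move=> abc; pose r := Num.sqrt (b ^+ 2 + c ^+ 2).
have r2 : r ^+ 2 = b ^+ 2 + c ^+ 2 by rewrite sqr_sqrtr// addr_ge0// sqr_ge0.
have [c1 [s1 [cs1 rc rs]]] :
    exists c1 s1, [/\ c1 ^+ 2 + s1 ^+ 2 = 1, r * c1 = c & r * s1 = b].
  have [r0|r0] := eqVneq r 0.
    exists 1, 0; rewrite r0 !mul0r expr1n expr0n/= addr0.
    move: r2; rewrite r0 expr0n/= => /esym/eqP.
    by rewrite paddr_eq0 ?sqr_ge0// !sqrf_eq0 => /andP[/eqP -> /eqP ->].
  exists (c / r), (b / r); rewrite ![r * _]mulrC !divfK//; split => //.
  by rewrite !expr_div_n -mulrDl addrC -r2 divff// sqrf_eq0.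
have rar : r ^+ 2 + a ^+ 2 = 1 by rewrite r2 -abc; ring.
exists (rotation_xz r a \o rotation_yz c1 s1); split.
- by apply: preserves_comp; [exact: preserves_rotation_xz|exact: preserves_rotation_yz].
- move=> [[x y] z]; rewrite !eucl_norm_triple /rotation_xz /rotation_yz/=.
  congr Num.sqrt.
  transitivity ((r ^+ 2 + a ^+ 2) * x ^+ 2 + (c1 ^+ 2 + s1 ^+ 2) * y ^+ 2
    + (c1 ^+ 2 + s1 ^+ 2) * z ^+ 2
    + (r ^+ 2 + a ^+ 2 - 1) * (s1 * y + c1 * z) ^+ 2); first by ring.
  by rewrite rar cs1; ring.
- move=> [[x y] z]; rewrite /rotation_xz /rotation_yz/=.
  by rewrite -rc -rs; ring.
Qed.

Lemma ball_prob_rotated_cap (a b c t : R) :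
    a ^+ 2 + b ^+ 2 + c ^+ 2 = 1 -> 0 < t <= 1 ->
  ball_prob [set z : R * R * R | t * eucl_norm (triple_tuple z) <=
    a * z.1.1 + b * z.1.2 + c * z.2] = ((1 - t) / 2)%:E.
Proof.
move=> /rotation_to_z[psi [[mpsi ppsi] normE zE]] t01.
rewrite -(ball_prob_cap t01) /ball_prob; congr (_ * _)%E.
rewrite [in RHS]setIC -/(cap t) -[RHS](ppsi _ (measurable_cap t)).
congr (mu3 _); apply/funext => z.
rewrite /cap /punctured_ball/= normE zE.
by apply/propext; split => -[].
Qed.

End ball.

(** * From tails to the cdf *)

Section tails.
Context {R : realType} {d : measure_display} {T : measurableType d}.
Variables (P : probability T R) (U : T -> R).
Hypothesis mU : measurable_fun setT U.

Let mle t : measurable [set x | U x <= t].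
Proof.
rewrite -[X in measurable X]setTI.
exact: (measurable_fun_ler mU (measurable_cst t) measurableT (Y := [set true])).
Qed.

Let mge t : measurable [set x | t <= U x].
Proof.
rewrite -[X in measurable X]setTI.
exact: (measurable_fun_ler (measurable_cst t) mU measurableT (Y := [set true])).
Qed.

(** Cones give tails with weak inequalities and away from level 0 only, so atoms have to be
    excluded. For 0 <= t < 1, upper tails at levels slightly above [t] bound [F t] from above; the
    tail at [t] itself bounds it from below, except at 0, where [F (- s)] for small [s] does. *)
Lemma unif_cdf_tails :
    (forall t, 0 < t <= 1 -> P [set x | t <= U x] = ((1 - t) / 2)%:E) ->
    (forall t, 0 < t <= 1 -> P [set x | U x <= - t] = ((1 - t) / 2)%:E) ->
  forall t, P [set x | U x <= t] = (unif_cdf t)%:E.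
Proof.
move=> Pge Ple t; pose F s := fine (P [set x | U x <= s]).
have PF s : P [set x | U x <= s] = (F s)%:E by rewrite fineK ?fin_num_measure.
have F0 s : 0 <= F s by rewrite -lee_fin -PF.
have F1 s : F s <= 1 by rewrite -lee_fin -PF probability_le1.
have Fmono s s' : s <= s' -> F s <= F s'.
  move=> ss'; rewrite -lee_fin -!PF le_measure ?inE// => x /=.
  by move=> /le_trans; apply.
have Fneg s : 0 < s <= 1 -> F (- s) = (1 - s) / 2.
  by move=> /Ple; rewrite PF => -[].
have Fle s : 0 < s <= 1 -> (1 + s) / 2 <= F s.
  move=> s1; have : (1 - P [set x | (U x <= s)%R] <= P [set x | (s <= U x)%R])%E.
    rewrite -probability_setC// le_measure ?inE//; first exact: measurableC.
    by move=> x /= /negP; rewrite -ltNge => /ltW.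
  by rewrite Pge// PF -EFinB lee_fin; lra.
have Fge s s' : 0 < s' <= 1 -> s < s' -> F s <= (1 + s') / 2.
  move=> s1 ss'; have : (P [set x | (s' <= U x)%R] <= 1 - P [set x | (U x <= s)%R])%E.
    rewrite -probability_setC// le_measure ?inE//; first exact: measurableC.
    by move=> x /= s'U; apply/negP; rewrite -ltNge (lt_le_trans ss').
  by rewrite Pge// PF -EFinB lee_fin; lra.
rewrite PF; congr EFin; rewrite /unif_cdf; case: ltP => t1.
  apply/eqP; rewrite eq_le F0 andbT (le_trans (Fmono t (-1) (ltW t1)))//.
  by rewrite Fneg ?ltr01 ?lexx// subrr mul0r.
case: ltP => t2; last first.
  apply/eqP; rewrite eq_le F1/= (le_trans _ (Fmono 1 t t2))//.
  by rewrite (le_trans _ (Fle 1 _)) ?ltr01 ?lexx//; lra.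
have [t0|t0] := ltP t 0.
  by rewrite -[in LHS](opprK t) Fneg; [rewrite opprK|lra].
apply/eqP; rewrite eq_le; apply/andP; split.
- apply/ler_addgt0Pr => e e0; pose s' := Num.min 1 (t + e).
  have ts' : t < s' by rewrite lt_min t2 ltrDl.
  have s'1 : s' <= 1 by rewrite ge_min lexx.
  have s'e : s' <= t + e by rewrite ge_min lexx orbT.
  by rewrite (le_trans (Fge t s' _ ts'))//; lra.
- have [->|tn0] := eqVneq t 0; last first.
    by apply: Fle; rewrite lt_def tn0 t0 ltW.
  apply/ler_addgt0Pr => e e0; pose s := Num.min 1 e.
  have s0 : 0 < s by rewrite lt_min ltr01.
  have s1 : s <= 1 by rewrite ge_min lexx.
  have se : s <= e by rewrite ge_min lexx orbT.
  have := Fmono (- s) 0; rewrite oppr_le0 (ltW s0) Fneg ?s0// => /(_ isT).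
  lra.
Qed.

End tails.

(** * Integrals under a uniform law given by its cdf *)

Section uniform_law.
Context {R : realType}.
Notation mu := (@lebesgue_measure R).

Lemma ltrN11 : (-1 : R) < 1. Proof. lra. Qed.

Lemma uniform_prob_gt (x : R) :
  uniform_prob ltrN11 `]x, +oo[%classic = (1 - unif_cdf x)%:E.
Proof.
have mx : measurable (`]x, +oo[%classic : set (measurableTypeR R)) by [].
transitivity (\int[uniform_prob ltrN11]_y
  (\1_(`]x, +oo[%classic : set (measurableTypeR R)) y)%:E)%E.
  by rewrite integral_indic// setIT.
rewrite integral_uniform//; last by apply/measurable_EFinP; exact: measurable_indic.
rewrite integral_indic// opprK.
rewrite /unif_cdf; case: ltP => x1.
  rewrite (_ : _ `&` _ = `[-1, 1]%classic); last first.
    by apply/seteqP; split => y /=; rewrite !in_itv/= andbT => *; lra.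
  rewrite [X in (_ * X)%E]lebesgue_measure_itv/= lte_fin ltrN11 -EFinB -EFinM.
  by congr EFin; field.
case: ltP => x2.
  rewrite (_ : _ `&` _ = `]x, 1]%classic); last first.
    apply/seteqP; split => y /=; rewrite !in_itv/= andbT.
      by move=> [-> /andP[_ ->]].
    by move=> /andP[xy ->]; split => //; lra.
  rewrite [X in (_ * X)%E]lebesgue_measure_itv/= lte_fin x2 -EFinB -EFinM.
  by congr EFin; field.
rewrite (_ : _ `&` _ = set0) ?measure0 ?mule0 ?subrr//.
by apply/seteqP; split => // y [] /=; rewrite !in_itv/= => *; lra.
Qed.

Context {d : measure_display} {T : measurableType d}.
Variables (P : probability T R) (U : T -> R).
Hypothesis mU : measurable_fun setT U.
Hypothesis cdfU : forall t, P [set x | U x <= t] = (unif_cdf t)%:E.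

(** The rays ]x, +oo[ form a generating pi-system, so the cdf identifies the law of [U] with the
    uniform law on [-1, 1]. *)
Lemma integral_unif_law (f : R -> \bar R) : measurable_fun setT f ->
    (forall t, 0 <= f t)%E ->
  (\int[P]_x f (U x) = 2^-1%:E * \int[mu]_(t in `[(-1)%R, 1%R]) f t)%E.
Proof.
move=> mf f0.
pose X0 (x : T) : measurableTypeR R := U x.
have mX0 : measurable_fun setT X0 by [].
pose X : {RV P >-> measurableTypeR R} :=
  HB.pack X0 (isMeasurableFun.Build _ _ _ _ X0 mX0).
have mf' : measurable_fun setT (f : measurableTypeR R -> \bar R) by [].
rewrite -[LHS](ge0_integral_distribution X mf')//.
rewrite (eq_measure_integral (uniform_prob ltrN11)).
  by rewrite integral_uniform// opprK.
move=> A mA _.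
apply: (@measure_unique _ R (measurableTypeR R) (@RGenOInfty.G R)
    (fun n => `](- n%:R), +oo[%classic) (RGenOInfty.measurableE R) _ _ _
    (distribution P X) (uniform_prob ltrN11)) => //.
- move=> _ _ [x ->] [y ->]; exists (Num.max x y).
  by apply/seteqP; split => z /=; rewrite !in_itv/= !andbT gt_max => *; apply/andP.
- by move=> n; exists (- n%:R).
- apply/seteqP; split => // x _; exists (Num.bound `|x|) => //=.
  rewrite in_itv/= andbT ltrNl (le_lt_trans _ (archi_boundP _))//.
  by rewrite -normrN ler_norm.
- move=> _ [x ->]; rewrite [RHS](uniform_prob_gt x).
  transitivity (P (~` [set z | U z <= x])).
    congr (P _); apply/seteqP; split => z /=; rewrite in_itv/= andbT.
      by rewrite ltNge => /negP.
    by move=> /negP; rewrite -ltNge.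
  rewrite probability_setC ?cdfU// -[X in measurable X]setTI.
  exact: (measurable_fun_ler mU (measurable_cst x) measurableT (Y := [set true])).
- by move=> n; rewrite ltey_eq fin_num_measure.
Qed.

End uniform_law.

(** * The spatial case *)

Section dimension3.
Context {R : realType}.
Notation mu := (@lebesgue_measure R).
Notation mu3 := (mu \x mu \x mu)%E.

(** Directions are drawn from [ball_prob], as is the spherical copula, so that [dir_sum_cdf] yields
    both the moments of a random direction and the projections of the copula. *)
Definition sphere_dir (i : 'I_3) (z : R * R * R) : R :=
  tnth (radial_proj (triple_tuple z)) i.

Let measurable_sphere_dir i : measurable_fun setT (sphere_dir i).
Proof.
apply: (measurableT_comp (measurable_tnth i)).
exact: (measurableT_comp (@measurable_radial_proj R 3) measurable_triple_tuple).
Qed.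

Let sum3E (F : 'I_3 -> R) : \sum_(i < 3) F i = F 0 + F 1 + F (inord 2).
Proof.
rewrite !big_ord_recl big_ord0 addr0 addrA.
have -> : lift ord0 ord0 = 1 :> 'I_3 by exact/val_inj.
by have -> : lift ord0 (lift ord0 ord0) = inord 2 :> 'I_3
  by apply/val_inj; rewrite /= inordK.
Qed.

Let measurable_dir_sum (v : 'I_3 -> R) :
  measurable_fun setT (fun z => \sum_(i < 3) sphere_dir i z * v i).
Proof. by apply: measurable_sum => i; apply: measurable_funM. Qed.

Let dir_sumE (v : 'I_3 -> R) (z : R * R * R) :
  \sum_(i < 3) sphere_dir i z * v i =
  (v 0 * z.1.1 + v 1 * z.1.2 + v (inord 2) * z.2) / eucl_norm (triple_tuple z).
Proof.
rewrite sum3E /sphere_dir !tnth_mktuple !(tnth_nth 0) inordK//=; ring.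
Qed.

Let norm_sphere_dir (z : R * R * R) : punctured_ball z ->
  \sum_(i < 3) sphere_dir i z ^+ 2 = 1.
Proof.
move=> /andP[n0 _].
under eq_bigr do rewrite /sphere_dir tnth_mktuple expr_div_n.
rewrite -mulr_suml -[X in X / _]sqr_sqrtr; last first.
  by apply: sumr_ge0 => i _; exact: sqr_ge0.
by rewrite divff// sqrf_eq0 gt_eqF.
Qed.

Let ball_prob_eq (X Y : set (R * R * R)) :
  (forall z, punctured_ball z -> X z <-> Y z) -> ball_prob X = ball_prob Y.
Proof.
move=> XY; rewrite /ball_prob; congr (_ * mu3 _)%E.
by apply/seteqP; split => z [zX zB]; split => //; apply/XY.
Qed.

(** Multiplying by the norm, positive on the punctured ball, turns the upper tail into a cone around
    [v] and the lower tail into one around [- v]. *)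
Let dir_sum_cdf (v : 'I_3 -> R) : \sum_(i < 3) v i ^+ 2 = 1 ->
  forall t, ball_prob [set z | \sum_(i < 3) sphere_dir i z * v i <= t] =
            (unif_cdf t)%:E.
Proof.
rewrite sum3E => v1; apply: unif_cdf_tails => [|t t01|t t01].
- exact: measurable_dir_sum.
- rewrite -(ball_prob_rotated_cap v1 t01); apply: ball_prob_eq => z /andP[n0 _] /=.
  by rewrite dir_sumE ler_pdivlMr.
- rewrite -(@ball_prob_rotated_cap _ (- v 0) (- v 1) (- v (inord 2)) t _ t01);
    last first.
    by rewrite !sqrrN.
  apply: ball_prob_eq => z /andP[n0 _] /=.
  by rewrite dir_sumE ler_pdivrMr// !mulNr -!opprD lerNr.
Qed.

Let integral_abs11 : (\int[mu]_(t in `[(-1)%R, 1%R]) `|t|%:E = 1%:E)%E.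
Proof.
rewrite -integral_itv_bndo_bndc; last exact/measurable_funTS/measurable_EFinP.
rewrite integral_mkcond.
transitivity (\int[mu]_t (if -1 <= t < 0 then 0 * t ^+ 2 + -1 * t + 0
     else if 0 <= t < 1 then 0 * t ^+ 2 + 1 * t + 0 else 0)%:E)%E.
  apply: eq_integral => t _; rewrite patchE mem_setE in_itv/=.
  case: (ltP t 0) => t0; rewrite ?andbT ?andbF/=.
    rewrite (lt_trans t0)// andbT; case: ifP => _ //.
    by rewrite ltr0_norm//; congr EFin; ring.
  rewrite (le_trans _ t0)//=; case: ifP => _ //.
  by rewrite ger0_norm//; congr EFin; ring.
rewrite integral_two_quadratics//.
- by congr EFin; field.
- by move=> t /andP[? ?]; lra.
- by move=> t /andP[? ?]; lra.
Qed.

Let integral_sqr11 : (\int[mu]_(t in `[(-1)%R, 1%R]) (t ^+ 2)%:E = (2 / 3)%:E)%E.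
Proof.
rewrite [LHS](@integral_is_derive R (fun t : R => t ^+ 3 / 3)
  (fun t : R => t ^+ 2))//.
- by congr EFin; field.
- exact: exprn_continuous.
- by move=> t; apply: is_derive_eq; rewrite /GRing.scale/=; field.
Qed.

(** Reduces the moments to unit vectors; for [v] zero any unit vector serves. *)
Let unit_scaling (v : 'I_3 -> R) : exists u : 'I_3 -> R,
  \sum_(i < 3) u i ^+ 2 = 1 /\
  forall i, v i = Num.sqrt (\sum_(i < 3) v i ^+ 2) * u i.
Proof.
set s := Num.sqrt _.
have s2 : s ^+ 2 = \sum_(i < 3) v i ^+ 2.
  by rewrite sqr_sqrtr// sumr_ge0// => i _; exact: sqr_ge0.
have [s0|s0] := eqVneq s 0.
  exists (fun i => (i == 0)%:R); split.
    have i20 : (inord 2 == 0 :> 'I_3) = false by rewrite -val_eqE/= inordK.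
    by rewrite sum3E i20/= expr1n expr0n/= !addr0.
  move=> i; rewrite s0 mul0r; apply/eqP; rewrite -sqrf_eq0.
  have /eqP : \sum_(i < 3) v i ^+ 2 = 0 by rewrite -s2 s0 expr0n.
  rewrite psumr_eq0; last by move=> j _; exact: sqr_ge0.
  by move=> /allP/(_ i (mem_index_enum _)).
exists (fun i => v i / s); split; last by move=> i; rewrite mulrC divfK.
under eq_bigr do rewrite expr_div_n.
by rewrite -mulr_suml -s2 divff// sqrf_eq0.
Qed.

Let scaled_sum (v u : 'I_3 -> R) (s : R) z : (forall i, v i = s * u i) ->
  \sum_(i < 3) sphere_dir i z * v i = s * \sum_(i < 3) sphere_dir i z * u i.
Proof.
by move=> vu; rewrite mulr_sumr; apply: eq_bigr => i _; rewrite vu mulrCA.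
Qed.

(** The constant is the mean of |t| for [t] uniform on [-1, 1], the law of the projection of a
    random direction on a unit vector. *)
Let sphere_abs_moment (v : 'I_3 -> R) :
  (\int[ball_prob]_z `|\sum_(i < 3) sphere_dir i z * v i|%:E =
   (2^-1 * Num.sqrt (\sum_(i < 3) v i ^+ 2))%:E)%E.
Proof.
have [u [u1 vu]] := unit_scaling v; set s := Num.sqrt _ in vu *.
have mabs : measurable_fun setT (fun t : R => (s * `|t|)%:E : \bar R).
  by apply/measurable_EFinP; apply: measurable_funM.
under eq_integral do rewrite (scaled_sum _ vu) normrM (ger0_norm (sqrtr_ge0 _)).
rewrite (integral_unif_law (measurable_dir_sum u) (dir_sum_cdf u1) mabs); last first.
  by move=> t; rewrite lee_fin mulr_ge0// sqrtr_ge0.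
under eq_integral do rewrite EFinM.
rewrite ge0_integralZl//.
- by rewrite [X in (_ * (_ * X))%E]integral_abs11 mule1.
- exact/measurable_funTS/measurable_EFinP.
- by rewrite lee_fin sqrtr_ge0.
Qed.

Let sphere_sqr_moment (v : 'I_3 -> R) :
  (\int[ball_prob]_z ((\sum_(i < 3) sphere_dir i z * v i) ^+ 2)%:E =
   (3%:R^-1 * \sum_(i < 3) v i ^+ 2)%:E)%E.
Proof.
have [u [u1 vu]] := unit_scaling v; set s := Num.sqrt _ in vu *.
have s2 : s ^+ 2 = \sum_(i < 3) v i ^+ 2.
  by rewrite sqr_sqrtr// sumr_ge0// => i _; exact: sqr_ge0.
have msqr : measurable_fun setT (fun t : R => (s ^+ 2 * t ^+ 2)%:E : \bar R).
  by apply/measurable_EFinP; apply: measurable_funM => //; exact: measurable_funX.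
under eq_integral do rewrite (scaled_sum _ vu) exprMn.
rewrite (integral_unif_law (measurable_dir_sum u) (dir_sum_cdf u1) msqr); last first.
  by move=> t; rewrite lee_fin mulr_ge0// sqr_ge0.
under eq_integral do rewrite EFinM.
rewrite ge0_integralZl//.
- rewrite [X in (_ * (_ * X))%E]integral_sqr11 -!EFinM -s2.
  by congr EFin; field.
- by apply/measurable_funTS/measurable_EFinP; exact: measurable_funX.
- by move=> t _; rewrite lee_fin sqr_ge0.
- by rewrite lee_fin sqr_ge0.
Qed.

(** Here the direction given by [w] is fixed and the point is random; the inner product is the one
    of [dir_sum_cdf], and [w] in the punctured ball makes the direction a unit vector. *)
Lemma spherical_copula3_proj_le (w : R * R * R) (t : R) : punctured_ball w ->
  spherical_copula3 R [set x | dir_proj sphere_dir w x <= t] = (unif_cdf t)%:E.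
Proof.
move=> /norm_sphere_dir w1; rewrite -(dir_sum_cdf w1 t).
transitivity (ball_prob [set z : R * R * R | dir_proj sphere_dir w
  (to_unit_cube (radial_proj (triple_tuple z))) <= t]) => //.
congr (ball_prob _); apply/funext => z /=; congr (is_true (_ <= _)).
apply: eq_bigr => i _; rewrite [tnth (to_unit_cube _) i]tnth_mktuple.
by rewrite /sphere_dir; field.
Qed.

Let half_gt0 : 0 < (2^-1 : R). Proof. by rewrite invr_gt0. Qed.

Let slopeE : (3 * 2^-1 : R)^-1 = 2 / 3.
Proof. by field. Qed.

Lemma mean_dist_spherical_copula3 :
  mean_dist (spherical_copula3 R) (spherical_copula3 R) = (2 / 3)%:E.
Proof.
rewrite -slopeE.
apply: (mean_dist_unif_proj measurable_sphere_dir half_gt0 sphere_abs_moment).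
exists (~` @punctured_ball R); split.
- by apply: measurableC; exact: measurable_punctured_ball.
- transitivity ((fine (mu3 (@punctured_ball R)))^-1%:E *
    mu3 (~` punctured_ball `&` @punctured_ball R))%E => //.
  by rewrite setICl measure0 mule0.
- move=> w /=; apply: contra_not => wB t; exact: spherical_copula3_proj_le.
Qed.

Lemma mean_dist_copula3_le (C : probability (3.-tuple R) R) : is_copula C ->
  (mean_dist C C <= (2 / 3)%:E)%E.
Proof.
move=> Ccop; rewrite -slopeE.
exact: (mean_dist_copula_le measurable_sphere_dir half_gt0 sphere_abs_moment
  sphere_sqr_moment).
Qed.

End dimension3.

Theorem theorem11 (R : realType) :
  ((forall C : probability (2.-tuple R) R, is_copula C ->
      (mean_dist C C
         <= mean_dist (spherical_copula2 R) (spherical_copula2 R))%E) /\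
   mean_dist (spherical_copula2 R) (spherical_copula2 R) = (pi / 6)%:E) /\
  ((forall C : probability (3.-tuple R) R, is_copula C ->
      (mean_dist C C
         <= mean_dist (spherical_copula3 R) (spherical_copula3 R))%E) /\
   mean_dist (spherical_copula3 R) (spherical_copula3 R) = (2 / 3)%:E).
Proof.
rewrite mean_dist_spherical_copula2 mean_dist_spherical_copula3.
split; split => //; [exact: mean_dist_copula2_le|exact: mean_dist_copula3_le].
Qed.
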